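(* Let $d\ge1$ and $n\ge1$ be integers. If $f,g$ are functions on $\triangle_H$ with $f\bar g\in\mathcal{TC}_{2n-1}$, then $$\langle f,g\rangle_{\triangle_H}=\langle f,g\rangle_{\triangle,n}.$$ Moreover, the following cubature formula is exact (equality holds) for all $f\in\mathcal{TC}_{2n-1}$: $$\frac1{|\triangle_H|}\int_{\triangle_H}f(\mathbf t)\,d\mathbf t=\frac1{(d+1)n^d}\sum_{\mathbf j\in\Lambda_n}\lambda_{\mathbf j}^{(n)}f\big(\tfrac{\mathbf j}{(d+1)n}\big).$$ In particular, $$\langle \mathsf{TC}_{\mathbf k},\mathsf{TC}_{\mathbf j}\rangle_{\triangle,n}=\frac{\delta_{\mathbf k,\mathbf j}}{\lambda_{\mathbf k}^{(n)}},\qquad \mathbf k,\mathbf j\in\Lambda_n.$$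
   Context: Let $\mathbb{R}_H^{d+1}=\{\mathbf t\in\mathbb{R}^{d+1}:t_1+\cdots+t_{d+1}=0\}$ with $d$-dimensional Lebesgue (surface) measure $d\mathbf t$, and let $\triangle_H=\{\mathbf t\in\mathbb{R}_H^{d+1}:0\le t_i-t_j\le1,\ 1\le i<j\le d+1\}$, with measure $|\triangle_H|=\sqrt{d+1}/(d+1)!$. Let $\mathbb{H}=\{\mathbf k\in\mathbb{Z}^{d+1}:k_1+\cdots+k_{d+1}=0,\ k_1\equiv\cdots\equiv k_{d+1}\ (\mathrm{mod}\ d+1)\}$, $\phi_{\mathbf k}(\mathbf t)=e^{\frac{2\pi i}{d+1}\mathbf k\cdot\mathbf t}$ for $\mathbf k\in\mathbb{H}$, and let $\mathcal{G}=S_{d+1}$ act by permuting coordinates, $\mathbf t\mapsto\mathbf t\sigma$. The generalized cosine functions are $\mathsf{TC}_{\mathbf k}(\mathbf t)=\frac1{(d+1)!}\sum_{\sigma\in\mathcal{G}}\phi_{\mathbf k}(\mathbf t\sigma)$. Let $$\Lambda_n=\{\mathbf k\in\mathbb{H}:k_{d+1}\le k_d\le\cdots\le k_1\le k_{d+1}+(d+1)n\},\qquad \mathcal{TC}_n=\mathrm{span}\{\mathsf{TC}_{\mathbf k}:\mathbf k\in\Lambda_n\}.$$ For $\mathbf j\in\Lambda_n$ write $\mathbf j=(\{j_1\}^{p_1},\dots,\{j_\ell\}^{p_\ell})$ with distinct values $j_1>\cdots>j_\ell$ repeated $p_1,\dots,p_\ell\ge1$ times, $p_1+\cdots+p_\ell=d+1$,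 and set $$\lambda_{\mathbf j}^{(n)}=\begin{cases}\dfrac{(d+1)!}{p_1!\,p_2!\cdots p_\ell!}&\text{if } j_1<j_\ell+(d+1)n,\\[8pt] \dfrac{(d+1)!}{(p_1+p_\ell)!\,p_2!\cdots p_{\ell-1}!}&\text{if } j_1=j_\ell+(d+1)n.\end{cases}$$ The inner products are $$\langle f,g\rangle_{\triangle_H}=\frac1{|\triangle_H|}\int_{\triangle_H}f(\mathbf t)\overline{g(\mathbf t)}\,d\mathbf t,\qquad \langle f,g\rangle_{\triangle,n}=\frac1{(d+1)n^d}\sum_{\mathbf j\in\Lambda_n}\lambda_{\mathbf j}^{(n)}f\big(\tfrac{\mathbf j}{(d+1)n}\big)\overline{g\big(\tfrac{\mathbf j}{(d+1)n}\big)}.$$ *)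

(* Defs.v *)
From HB Require Import structures.
From mathcomp Require Import all_boot all_order all_algebra perm.
From mathcomp Require Import all_classical all_reals all_analysis.
From mathcomp Require Import complex zify.

Set Implicit Arguments.
Unset Strict Implicit.
Unset Printing Implicit Defensive.

Import Order.TTheory GRing.Theory Num.Theory.
Import numFieldNormedType.Exports.

Local Open Scope classical_set_scope.
Local Open Scope ring_scope.

Section TupleMeasure.
Context disp (T : measurableType disp) (R : realType).

Definition tcons n (p : T * n.-tuple T) : n.+1.-tuple T :=
  [tuple of p.1 :: p.2].

Definition tuncons n (t : n.+1.-tuple T) : T * n.-tuple T :=
  (tnth t ord0, [tuple of behead t]).

Lemma measurable_tcons n : measurable_fun [set: T * n.-tuple T] (@tcons n).
Proof. exact: measurable_cons. Qed.

Lemma measurable_tuncons n : measurable_fun [set: n.+1.-tuple T] (@tuncons n).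
Proof.
apply/measurable_fun_pair; first exact: measurable_tnth.
exact: measurable_behead.
Qed.

Lemma tconsK n : cancel (@tcons n) (@tuncons n).
Proof. by case=> x t; congr pair; apply: val_inj. Qed.

Variable mu : {sigma_finite_measure set T -> \bar R}.

Section Step.
Variables (n : nat) (nu : {sigma_finite_measure set (n.-tuple T) -> \bar R}).

Definition measure_cons : set (n.+1.-tuple T) -> \bar R :=
  pushforward (product_measure1 mu nu) (@tcons n).

HB.instance Definition _ := Measure.copy measure_cons
  (measure_function_pushforward__canonical__measure_function_Measure
     (product_measure1 mu nu) (@measurable_tcons n)).

Let measure_cons_sigma_finite : sigma_finite setT measure_cons.
Proof.
have /sigma_finiteP[F [TF ndF Foo]] := sigma_finiteT mu.
have /sigma_finiteP[G [TG ndG Goo]] := sigma_finiteT nu.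
exists (fun i => @tuncons n @^-1` (F i `*` G i)).
  apply/esym/seteqP; split => // t _.
  have [i _ Fi] : (\bigcup_i F i) (tuncons t).1 by rewrite -TF.
  have [j _ Gj] : (\bigcup_j G j) (tuncons t).2 by rewrite -TG.
  exists (maxn i j) => //; split.
  - by move: Fi; exact/subsetPset/ndF/leq_maxl.
  - by move: Gj; exact/subsetPset/ndG/leq_maxr.
move=> i; have [mF Fi] := Foo i; have [mG Gi] := Goo i.
have mFG : measurable (F i `*` G i) by exact: measurableX.
split; first by rewrite -[X in measurable X]setTI; exact: measurable_tuncons.
rewrite /measure_cons /pushforward -comp_preimage.
rewrite (_ : @tuncons n \o @tcons n = id); last by apply/funext; exact: tconsK.
by rewrite preimage_id product_measure1E// lte_mul_pinfty// ge0_fin_numE.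
Qed.

HB.instance Definition _ :=
  Measure_isSigmaFinite.Build _ _ _ measure_cons measure_cons_sigma_finite.

End Step.

(* The n-fold product mu \x ... \x mu; for n = 0, the unit mass at the unique
   point. *)
Fixpoint power_measure n : {sigma_finite_measure set (n.-tuple T) -> \bar R} :=
  if n is m.+1 then measure_cons (power_measure m)
  else dirac ([tuple] : 0.-tuple T).

End TupleMeasure.

(* measurableTypeR R, the carrier of lebesgue_measure, is convertible to R but
   has another display; with R itself the measure types do not unify. *)
Definition lebesgue_tuple (R : realType) (n : nat) :
    {sigma_finite_measure set (n.-tuple (measurableTypeR R)) -> \bar R} :=
  power_measure (@lebesgue_measure R) n.

Section Hyperplane.
Variables (R : realType) (d : nat).

Definition hyperplane : set (d.+1.-tuple R) :=
  [set t | \sum_(i < d.+1) tnth t i = 0].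

(* The hyperplane is the graph of u |-> - (u_1 + ... + u_d) over R^d. *)
Definition hyperplane_graph (u : d.-tuple R) : d.+1.-tuple R :=
  [tuple of rcons u (- \sum_(i < d) tnth u i)].

Lemma hyperplane_graphP u : hyperplane (hyperplane_graph u).
Proof.
rewrite /hyperplane /= big_ord_recr /=.
rewrite [X in _ + X](_ : _ = - \sum_(i < d) tnth u i); last first.
  by rewrite (tnth_nth 0) /= nth_rcons size_tuple ltnn eqxx.
apply/eqP; rewrite subr_eq0; apply/eqP/eq_bigr => i _.
by rewrite !(tnth_nth 0) /= nth_rcons size_tuple ltn_ord.
Qed.

Lemma measurable_hyperplane_graph :
  measurable_fun [set: d.-tuple (measurableTypeR R)]
    (hyperplane_graph : _ -> d.+1.-tuple (measurableTypeR R)).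
Proof.
apply/measurable_fun_tnthP => i.
have [id_|di] := ltnP i d.
  rewrite (_ : _ \o _ = fun u : d.-tuple (measurableTypeR R) =>
    tnth u (Ordinal id_)); first exact: measurable_tnth.
  by apply/funext => u /=; rewrite !(tnth_nth 0) /= nth_rcons size_tuple id_.
rewrite (_ : _ \o _ = fun u : d.-tuple (measurableTypeR R) =>
  - \sum_(i < d) (tnth u i : R)).
  apply: (@measurableT_comp _ _ _ _ _ _ (-%R : R -> R)) => //.
  by apply: measurable_sum => j; exact: measurable_tnth.
apply/funext => u /=; rewrite (tnth_nth 0) /= nth_rcons size_tuple ltnNge di /=.
by rewrite eqn_leq di -ltnS ltn_ord.
Qed.

Definition graph_measure : set (d.+1.-tuple (measurableTypeR R)) -> \bar R :=
  pushforward (lebesgue_tuple R d) hyperplane_graph.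

HB.instance Definition _ := Measure.copy graph_measure
  (measure_function_pushforward__canonical__measure_function_Measure
     (lebesgue_tuple R d) measurable_hyperplane_graph).

(* The area element of the graph of h is sqrt (1 + |grad h|^2) du, and here
   |grad h|^2 = d. *)
Definition surface : {measure set (d.+1.-tuple (measurableTypeR R)) -> \bar R} :=
  mscale (Num.sqrt d.+1%:R)%:nng graph_measure.

Definition triangleH : set (d.+1.-tuple R) :=
  [set t | hyperplane t /\
    forall i j : 'I_d.+1, (i < j)%N -> 0 <= tnth t i - tnth t j <= 1].

Definition mean_triangle (f : d.+1.-tuple R -> R[i]) : R[i] :=
  ((fine (surface triangleH))^-1)%:C%C *
  (\int[surface]_(t in triangleH) complex.Re (f t) +i*
   \int[surface]_(t in triangleH) complex.Im (f t))%C.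

Definition ip_triangle (f g : d.+1.-tuple R -> R[i]) : R[i] :=
  mean_triangle (fun t => f t * (g t)^*%C).

End Hyperplane.

Section Lattice.
Variable d : nat.
Implicit Types (k : d.+1.-tuple int) (n : nat).

Definition latticeH : set (d.+1.-tuple int) :=
  [set k | \sum_(i < d.+1) tnth k i = 0 /\
    forall i j : 'I_d.+1, (tnth k i = tnth k j %[mod (d.+1)%:Z])%Z].

Definition Lambda n : set (d.+1.-tuple int) :=
  [set k | [/\ latticeH k, sorted >=%R k
    & tnth k ord0 <= tnth k ord_max + (d.+1 * n)%:Z]].

(* Hence the sums \sum_(k \in Lambda n), which range over a finite support, are
   the ordinary finite ones. *)
Lemma finite_Lambda n : finite_set (Lambda n).
Proof.
pose N := (d.+1 * n)%N.
pose h (g : {ffun 'I_d.+1 -> 'I_(2 * N).+1}) :=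
  [tuple ((g i : nat)%:Z - N%:Z)%R | i < d.+1].
apply: (@sub_finite_set _ _ (range h)); last exact/finite_image/finite_finset.
move=> k [[k0 _] ksort kN].
have kle (i j : 'I_d.+1) : (i <= j)%N -> tnth k j <= tnth k i.
  move=> ij; rewrite !(tnth_nth 0).
  have getr : transitive (>=%R : rel int) by move=> a b c ba cb; exact: le_trans ba.
  have gerefl : reflexive (>=%R : rel int) by move=> a; exact: lexx.
  by apply: (sorted_leq_nth getr gerefl 0 ksort); rewrite ?inE ?size_tuple.
have k0max i : tnth k i <= tnth k ord0 by exact: kle.
have kmin i : tnth k ord_max <= tnth k i by apply: kle; rewrite -ltnS.
have kmax_ge0 : 0 <= tnth k ord0.
  rewrite leNgt; apply/negP => kneg; suff: \sum_(i < d.+1) tnth k i < 0.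
    by rewrite k0 ltxx.
  rewrite big_ord_recl ltr_wnDr// sumr_le0// => i _.
  exact: le_trans (k0max _) (ltW kneg).
have kmin_le0 : tnth k ord_max <= 0.
  rewrite leNgt; apply/negP => kpos; suff: 0 < \sum_(i < d.+1) tnth k i.
    by rewrite k0 ltxx.
  rewrite big_ord_recl ltr_wpDr ?(lt_le_trans kpos)// sumr_ge0// => i _.
  exact: le_trans (ltW kpos) (kmin _).
have kb i : 0 <= tnth k i + N%:Z <= (2 * N)%:Z.
  have kN' : tnth k ord0 <= tnth k ord_max + N%:Z := kN.
  have := k0max i; have := kmin i; clearbody N.
  move: (tnth k i) (tnth k ord0) (tnth k ord_max) kN' kmax_ge0 kmin_le0.
  move=> a b c; clear; lia.
exists [ffun i => inord (absz (tnth k i + N%:Z))] => //.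
apply: eq_from_tnth => i; rewrite tnth_mktuple ffunE inordK.
  by have := kb i; lia.
by have := kb i; lia.
Qed.

Variable R : realType.

(* For k in Lambda n the entries decrease, so the first and the last ones are
   the largest and the smallest of the distinct values, which undup lists;
   count_mem v k is the multiplicity of v. *)
Definition lambda n k : R :=
  let kmax := tnth k ord0 in
  let kmin := tnth k ord_max in
  if kmax < kmin + (d.+1 * n)%:Z then
    (d.+1)`!%:R / \prod_(v <- undup k) (count_mem v k)`!%:R
  else
    (d.+1)`!%:R / ((count_mem kmax k + count_mem kmin k)`!%:R *
      \prod_(v <- undup k | (v != kmax) && (v != kmin)) (count_mem v k)`!%:R).

Definition expi (x : R) : R[i] := (cos x +i* sin x)%C.

Definition phi k (t : d.+1.-tuple R) : R[i] :=
  expi (2 * pi / d.+1%:R * \sum_(i < d.+1) (tnth k i)%:~R * tnth t i).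

Definition permt (t : d.+1.-tuple R) (s : 'S_d.+1) : d.+1.-tuple R :=
  [tuple tnth t (s i) | i < d.+1].

Definition TC k (t : d.+1.-tuple R) : R[i] :=
  ((d.+1)`!%:R)^-1 * \sum_(s : 'S_d.+1) phi k (permt t s).

(* Elements of the span are regarded as functions on triangleH: the values of
   f elsewhere are irrelevant. *)
Definition TCspan n : set (d.+1.-tuple R -> R[i]) :=
  [set f | exists c : d.+1.-tuple int -> R[i],
    forall t, triangleH t -> f t = \sum_(k \in Lambda n) c k * TC k t].

Definition node n k : d.+1.-tuple R :=
  [tuple (tnth k i)%:~R / (d.+1 * n)%:R | i < d.+1].

Definition cubature n (f : d.+1.-tuple R -> R[i]) : R[i] :=
  ((d.+1 * n ^ d)%:R)^-1 *
  \sum_(j \in Lambda n) (lambda n j)%:C%C * f (node n j).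

Definition ip_discrete n (f g : d.+1.-tuple R -> R[i]) : R[i] :=
  cubature n (fun t => f t * (g t)^*%C).

End Lattice.

(* Main.v *)
Require Import Defs.
From HB Require Import structures.
From mathcomp Require Import all_boot all_order all_algebra perm.
From mathcomp Require Import all_classical all_reals all_analysis.
From mathcomp Require Import measurable_realfun complex zify ring lra.

(** Write N = (d+1) n.  By linearity the cubature formula only has to be checked
    on the generalized cosines TC_k, k in Lambda_{2n-1}; the first claim is the
    formula applied to the product of f and the conjugate of g.  On TC_k both
    sides turn out to be 1 for k = 0 and 0 otherwise.

    The continuous side (mean_triangle_TC).  In the coordinates y_i = t_i - t_{d+1}
    the triangle becomes the chamber 1 >= y_1 >= ... >= y_d >= 0 of the unit cube,
    with constant Jacobian (ge0_integral_shear), and TC_k becomes a symmetric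
    function of y.  The permuted chambers tile the cube (ge0_integral_cube), so
    the integral over the triangle is a multiple of the integral over the cube
    (Rintegral_triangleH).  There TC_k is a sum of products of exponentials in
    single variables, and Fubini's theorem gives a sum of products of elementary
    integrals, which vanishes for k <> 0 because the entries of k sum to zero
    (cintegral_TCchamber_eq0).

    The discrete side (cubature_TC).  Let X be the quotient of the lattice H by
    the integer vectors N a with sum of the a_i zero, a finite abelian group of
    order (d+1) n^d.  Up to permutation of the coordinates every element of X has
    a unique representative in Lambda_n (Lambda_residues_inj,
    Lambda_residues_surj), and the weight lambda_j is the size of the orbit of j
    (lambda_permutations).  Hence the cubature sum of a symmetric periodic
    function is its plain average over X (sum_cell_Lambda).  The function phi_k
    restricts to a character of X, which averages to 0 unless N divides all
    entries of k (sum_chi_cell); for k in Lambda_{2n-1} this means k = 0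
    (Lambda_dvd_eq0).

    The orthogonality relations follow from the same character sums: the
    characters k s - j r that are trivial on X come from pairs of permutations
    (s, r) that identify the orbits of k and j (ip_discrete_TC). *)

Set Implicit Arguments.
Unset Strict Implicit.
Unset Printing Implicit Defensive.

Import Order.TTheory GRing.Theory Num.Theory.
Import numFieldNormedType.Exports.

Local Open Scope classical_set_scope.
Local Open Scope ring_scope.

(** * Lebesgue measure on tuples under shears *)
Section TupleIntegral.
Context (R : realType).
Local Notation mu := (@lebesgue_measure R).
Local Notation RT := (measurableTypeR R).

Local Open Scope ereal_scope.

Lemma ge0_integral_lebesgue_tupleS n (f : n.+1.-tuple RT -> \bar R) :
  measurable_fun [set: n.+1.-tuple RT] f -> (forall t, 0 <= f t) ->
  \int[lebesgue_tuple R n.+1]_t f t =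
  \int[mu \x lebesgue_tuple R n]_p f (tcons p).
Proof.
move=> mf f0.
have := @ge0_integral_pushforward _ _ _ _ R (@tcons _ RT n) (@measurable_tcons _ RT n)
  (mu \x lebesgue_tuple R n) setT f measurableT mf (fun y _ => f0 y).
by rewrite preimage_setT.
Qed.

(** The image of Lebesgue measure under [x |-> a x + b], scaled by [a], has the
    right value on half-open intervals, hence is Lebesgue measure. *)
Lemma ge0_integral_affine (a b : R) (h : RT -> \bar R) : (0 < a)%R ->
  measurable_fun [set: RT] h -> (forall x, 0 <= h x) ->
  \int[mu]_x h (a * x + b)%R = a^-1%:E * \int[mu]_x h x.
Proof.
move=> a0 mh h0.
have maff : measurable_fun [set: RT] (fun x : RT => (a * x + b)%R : RT).
  by apply: measurable_funD => //; exact: measurable_funM.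
pose im := measure_function_pushforward__canonical__measure_function_Measure
  mu maff.
pose nu := mscale (NngNum (ltW a0)) im.
have nuE A : measurable A -> mu A = nu A.
  apply: lebesgue_measure_unique => _ [[x y] _ <-] /=.
  rewrite /nu /mscale /= /pushforward.
  rewrite (_ : _ @^-1` _ = `]((x - b) / a)%R, ((y - b) / a)%R]%classic); last first.
    apply/seteqP; split => z /=; rewrite !in_itv /= ltr_pdivrMr// ler_pdivlMr//;
      by rewrite ltrBlDr lerBrDr mulrC.
  rewrite !lebesgue_measure_itv /= !lte_fin ltr_pM2r ?invr_gt0// ltrD2r.
  case: ifPn => xy; last by rewrite mule0.
  rewrite -EFinB -EFinD -EFinM; congr EFin.
  by field; rewrite gt_eqF.
have E : \int[mu]_x h x = \int[nu]_x h x.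
  by apply: eq_measure_integral => A mA _; exact: nuE.
rewrite E ge0_integral_mscale// ge0_integral_pushforward// preimage_setT.
by rewrite muleA -EFinM mulVf ?mul1e ?gt_eqF.
Qed.

(** With [a = 1] and [b = 0] this sends the first [d] coordinates of a point [t]
    of the hyperplane to the differences [t_i - t_{d+1}].  The general [a] and
    [b] make a family that is stable under splitting off one coordinate. *)
Definition shear n (a b : R) (y : n.-tuple RT) : n.-tuple RT :=
  [tuple (tnth y i + a * (\sum_(j < n) (tnth y j : R)) + b)%R | i < n].

Lemma tnth_tcons0 d (T : measurableType d) n (p : T * n.-tuple T) : tnth (tcons p) ord0 = p.1.
Proof. exact: tnth0. Qed.

Lemma tnth_tconsS d (T : measurableType d) n (p : T * n.-tuple T) i :
  tnth (tcons p) (lift ord0 i) = tnth p.2 i.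
Proof. exact: tnthS. Qed.

Lemma measurable_shear d (T : measurableType d) n a (b : T -> R)
    (y : T -> n.-tuple RT) :
  measurable_fun [set: T] b -> measurable_fun [set: T] y ->
  measurable_fun [set: T] (fun x => shear a (b x) (y x)).
Proof.
move=> mb my; apply/measurable_fun_tnthP => i.
have mt j : measurable_fun [set: T] (fun x => tnth (y x) j : R).
  exact: (measurableT_comp (measurable_tnth j) my).
rewrite (_ : _ \o _ = fun x =>
  (tnth (y x) i + a * (\sum_(j < n) (tnth (y x) j : R)) + b x)%R : RT); last first.
  by apply/funext => x /=; rewrite tnth_mktuple.
apply: measurable_funD => //; apply: measurable_funD => //.
apply: measurable_funM => //.
by apply: measurable_sum => j.
Qed.

Lemma shear_tcons n (a b : R) (p : RT * n.-tuple RT) :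
  shear a b (tcons p) =
  tcons ((p.1 + a * (p.1 + \sum_(j < n) tnth p.2 j) + b)%R : RT,
         shear a (b + a * p.1)%R p.2).
Proof.
case: p => x y; apply: eq_from_tnth => i; rewrite tnth_mktuple big_ord_recl.
rewrite tnth_tcons0; under eq_bigr do rewrite tnth_tconsS.
have [->|i0] := eqVneq i ord0; first by rewrite !tnth_tcons0.
have [j ->] : exists j, i = lift ord0 j.
  by case: (unliftP ord0 i) i0 => [j ->|->]; [exists j|rewrite eqxx].
by rewrite !tnth_tconsS tnth_mktuple /=; ring.
Qed.

(** The Jacobian [1 + n a], by induction on the dimension.  For a fixed tail the
    new first coordinate [x'] is an affine function of [x] with slope [1 + a];
    rewritten in terms of [x'], the motion of the tail is again a shear, with
    [a / (1 + a)] in place of [a] and a translation that depends on [x'] only.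
    Tonelli's theorem allows the one-dimensional substitution first and the
    induction hypothesis next. *)
Lemma ge0_integral_shear n (a b : R) (h : n.-tuple RT -> \bar R) : (0 <= a)%R ->
  measurable_fun [set: n.-tuple RT] h -> (forall y, 0 <= h y) ->
  \int[lebesgue_tuple R n]_y h (shear a b y) =
  ((1 + n%:R * a)^-1)%:E * \int[lebesgue_tuple R n]_y h y.
Proof.
elim: n a b h => [|n IHn] a b h a0 mh h0.
  rewrite mul0r addr0 invr1 mul1e; apply: eq_integral => y _.
  by rewrite (tuple0 y) (tuple0 (shear _ _ _)).
have a1 : (0 < 1 + a)%R by rewrite ltr_wpDr.
(* The parameters of the shear of the tail once [x'] replaces [x]. *)
pose a' := (a / (1 + a))%R.
have a'0 : (0 <= a')%R by rewrite divr_ge0// ltW.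
pose b' (x : R) := ((b + a * x) / (1 + a))%R.
(* The integrand in the variables [(x', y)]. *)
pose g (p : RT * n.-tuple RT) := h (tcons (p.1, shear a' (b' p.1) p.2)).
have mb' : measurable_fun [set: RT] (b' : RT -> RT).
  rewrite /b'; apply: measurable_funM => //; exact: measurable_funD.
have mht : measurable_fun [set: RT * n.-tuple RT] (h \o @tcons _ RT n).
  by apply: measurableT_comp => //; exact: measurable_tcons.
have mg : measurable_fun [set: RT * n.-tuple RT] g.
  apply: (measurableT_comp mht); apply/measurable_fun_pair => //=.
  by apply: measurable_shear => //; exact: measurableT_comp.
have mhs : measurable_fun setT (h \o @shear n.+1 a b).
  by apply: measurableT_comp => //; exact: measurable_shear.
have mhst : measurable_fun setT (h \o @shear n.+1 a b \o @tcons _ RT n).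
  by apply: measurableT_comp => //; exact: measurable_tcons.
rewrite (ge0_integral_lebesgue_tupleS mhs (fun=> h0 _)).
rewrite (fubini_tonelli2 _ mhst (fun=> h0 _)).
transitivity (\int[lebesgue_tuple R n]_y ((1 + a)^-1%:E * \int[mu]_x g (x, y))).
  apply: eq_integral => y _; rewrite /fubini_G.
  pose c := (a * (\sum_(j < n) tnth y j) + b)%R.
  rewrite -(@ge0_integral_affine (1 + a) c (fun x => g (x, y)))//; last 2 first.
  - exact: (measurableT_comp mg (@pair2_measurable _ _ RT _ y)).
  - by move=> x; exact: h0.
  apply: eq_integral => x _ /=; rewrite shear_tcons /g /=; congr (h (tcons _)).
  congr pair; first by rewrite /c; ring.
  apply: eq_from_tnth => i; rewrite !tnth_mktuple /a' /b' /c.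
  by field; rewrite gt_eqF.
have mG := measurable_fun_fubini_tonelli_G (m1 := mu) g mg (fun=> h0 _).
rewrite ge0_integralZl//; last 2 first.
- by move=> y _; apply: integral_ge0 => x _; exact: h0.
- by rewrite lee_fin invr_ge0 ltW.
rewrite -(fubini_tonelli g mg (fun=> h0 _)).
transitivity ((1 + a)^-1%:E * \int[mu]_x ((1 + n%:R * a')^-1%:E *
    \int[lebesgue_tuple R n]_y h (tcons (x, y)))).
  congr *%E; apply: eq_integral => x _.
  rewrite -(IHn a' (b' x) (fun y => h (tcons (x, y))))//.
  exact: (measurableT_comp mht (@pair1_measurable _ _ _ (n.-tuple RT) x)).
have mF := measurable_fun_fubini_tonelli_F (m2 := lebesgue_tuple R n)
  (h \o @tcons _ RT n) mht (fun=> h0 _).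
rewrite ge0_integralZl//; last 2 first.
- by move=> x _; apply: integral_ge0 => y _; exact: h0.
- by rewrite lee_fin invr_ge0 addr_ge0// mulr_ge0.
rewrite (ge0_integral_lebesgue_tupleS mh)//.
rewrite (fubini_tonelli1 (h \o @tcons _ RT n) mht (fun=> h0 _)) muleA -EFinM; congr (_%:E * _).
rewrite -invfM; congr (_^-1)%R; rewrite /a' -natr1; field.
by rewrite gt_eqF.
Qed.

End TupleIntegral.

(** * Permutations of coordinates and the ordered chamber of the cube *)
Lemma sum_reindex_perm (V : nmodType) n (s : 'S_n) (f : 'I_n -> V) :
  \sum_(i < n) f (s i) = \sum_(i < n) f i.
Proof. by rewrite [RHS](reindex_inj (@perm_inj _ s)). Qed.

Lemma sorted_tnthP (R : numDomainType) n (y : n.-tuple R) :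
  sorted >=%R y <-> forall i j : 'I_n, (i <= j)%N -> (tnth y j <= tnth y i)%R.
Proof.
split=> [ysort i j ij|ysort].
  rewrite !(tnth_nth 0).
  have getr : transitive (>=%R : rel R) by move=> a b c ba cb; exact: le_trans ba.
  have gerefl : reflexive (>=%R : rel R) by move=> a; exact: lexx.
  by apply: (sorted_leq_nth getr gerefl 0 ysort); rewrite ?inE ?size_tuple.
rewrite sorted_pairwise; last by move=> a b c ba cb; exact: le_trans ba.
apply/(pairwiseP 0) => i j; rewrite !inE size_tuple => ilt jlt ij.
by have := ysort (Ordinal ilt) (Ordinal jlt) (ltnW ij); rewrite !(tnth_nth 0).
Qed.

Definition permv (T : Type) n (s : 'S_n) (y : n.-tuple T) : n.-tuple T :=
  [tuple tnth y (s i) | i < n].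

Section PermInvariance.
Context (R : realType).
Local Notation mu := (@lebesgue_measure R).
Local Notation RT := (measurableTypeR R).

Lemma measurable_permv n (s : 'S_n) :
  measurable_fun [set: n.-tuple RT] (@permv RT n s).
Proof.
apply/measurable_fun_tnthP => i.
rewrite (_ : _ \o _ = fun y : n.-tuple RT => tnth y (s i)).
  exact: measurable_tnth.
by apply/funext => y /=; rewrite tnth_mktuple.
Qed.

Definition box n (A : 'I_n -> set RT) : set (n.-tuple RT) :=
  [set t | forall i, A i (tnth t i)].

Lemma measurable_box n (A : 'I_n -> set RT) :
  (forall i, measurable (A i)) -> measurable (box A).
Proof.
move=> mA; rewrite (_ : box A = \bigcap_(i in setT) ((@tnth n RT)^~ i @^-1` A i)).
  apply: fin_bigcap_measurable => // i _; rewrite -[X in measurable X]setTI.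
  exact: measurable_tnth.
by apply/seteqP; split => t /= At; [move=> i _; exact: At|move=> i; exact: At].
Qed.

Lemma lebesgue_tuple_box n (A : 'I_n -> set RT) :
  (forall i, measurable (A i)) ->
  lebesgue_tuple R n (box A) = (\big[mule/1]_(i < n) mu (A i))%E.
Proof.
elim: n A => [|n IHn] A mA.
  rewrite big_ord0 /lebesgue_tuple /= diracE mem_set//.
  by move=> [].
rewrite big_ord_recl -IHn; last by move=> i; exact: mA.
rewrite -product_measure1E//; last by apply: measurable_box => i; exact: mA.
congr (product_measure1 mu (lebesgue_tuple R n) _).
apply/seteqP; split => -[x y] /=.
- move=> Axy; split => /=; first by have := Axy ord0; rewrite tnth_tcons0.
  by move=> i; have := Axy (lift ord0 i); rewrite tnth_tconsS.
- move=> [/= Ax Ay] i; case: (unliftP ord0 i) => [j ->|->].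
    by rewrite tnth_tconsS; exact: Ay.
  by rewrite tnth_tcons0.
Qed.

Lemma preimage_permv_box n (s : 'S_n) (A : 'I_n -> set RT) :
  permv s @^-1` box A = box (A \o (s^-1)%g).
Proof.
apply/seteqP; split => t /= At i.
  by have := At ((s^-1)%g i); rewrite tnth_mktuple permKV.
by have := At (s i); rewrite tnth_mktuple /= permK.
Qed.

(** Boxes are stable under intersection, generate the product sigma-algebra and
    have the same volume before and after permuting their sides. *)
Lemma lebesgue_tuple_permv n (s : 'S_n) (A : set (n.-tuple RT)) :
  measurable A -> lebesgue_tuple R n (permv s @^-1` A) = lebesgue_tuple R n A.
Proof.
move=> mA; apply/esym.
pose G := [set box B | B in [set B : 'I_n -> set RT | forall i, measurable (B i)]].
pose g k := @box n (fun=> [set` `[- k%:R, k%:R]%R]).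
pose im := measure_function_pushforward__canonical__measure_function_Measure
  (lebesgue_tuple R n) (measurable_permv s).
apply: (measure_unique G g _ _ _ _ (lebesgue_tuple R n) im) => //.
- apply/seteqP; split.
    apply: sub_sigma_algebra2; apply: (big_ind (fun S => S `<=` G)) => //.
    + by move=> S1 S2 S1G S2G S [/S1G|/S2G].
    + move=> i _ _ [Y mY <-]; exists (fun j => if j == i then Y else setT).
        by move=> j; case: ifP.
      rewrite setTI; apply/seteqP; split => t /=.
        by move=> /(_ i); rewrite eqxx.
      by move=> Yt j; case: eqP => [->|].
  apply: smallest_sub; first exact: sigma_algebra_measurable.
  by move=> _ [B mB <-]; exact: measurable_box.
- move=> _ _ [B1 mB1 <-] [B2 mB2 <-]; exists (fun i => B1 i `&` B2 i).
    by move=> i; exact: measurableI.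
  apply/seteqP; split => t /=.
    by move=> Bt; split => i; have [] := Bt i.
  by move=> [? ?] i; split.
- by move=> k; exists (fun=> [set` `[- k%:R, k%:R]%R]).
- apply/seteqP; split => // t _.
  have [k kt] : exists k : nat, \sum_(i < n) `|tnth t i| <= k%:R.
    exists (Num.truncn (\sum_(i < n) `|tnth t i|)).+1; apply: ltW.
    exact: truncnS_gt.
  exists k => // i; rewrite /= in_itv /= -ler_norml.
  by apply: le_trans kt; rewrite (bigD1 i)//= lerDl sumr_ge0.
- move=> _ [B mB <-]; rewrite /= /pushforward preimage_permv_box.
  rewrite !lebesgue_tuple_box//; last by move=> i; exact: mB.
  rewrite [RHS](reindex_inj (@perm_inj _ s)) /=.
  by apply: eq_bigr => i _; rewrite /= permK.
- move=> k; rewrite /= lebesgue_tuple_box//.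
  rewrite -ge0_fin_numE; last by apply: prode_ge0 => i _.
  apply: (big_ind (fun x => x \is a fin_num)%E) => //.
    by move=> x y; exact: fin_numM.
  by move=> i _; rewrite lebesgue_measure_itv /=; case: ifP.
Qed.

Local Open Scope ereal_scope.

Lemma ge0_integral_permv n (s : 'S_n) (f : n.-tuple RT -> \bar R) :
  measurable_fun [set: n.-tuple RT] f -> (forall y, 0 <= f y) ->
  \int[lebesgue_tuple R n]_y f (permv s y) = \int[lebesgue_tuple R n]_y f y.
Proof.
move=> mf f0.
have := @ge0_integral_pushforward _ _ _ _ R (@permv RT n s)
  (measurable_permv s) (lebesgue_tuple R n) setT f measurableT mf (fun y _ => f0 y).
rewrite preimage_setT => <-.
apply: eq_measure_integral; first exact: measurable_permv.
by move=> mp A mA _; rewrite /= /pushforward lebesgue_tuple_permv.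
Qed.

Definition ties n : set (n.-tuple RT) := [set y | ~~ uniq y].

Lemma measurable_ties n : measurable (@ties n).
Proof.
have -> : @ties n = \bigcup_(p in [set p : 'I_n * 'I_n | p.1 != p.2])
    [set y : n.-tuple RT | (tnth y p.1 : R) == tnth y p.2].
  apply/seteqP; split => y /=.
    move=> /negP nuy; apply: contrapT => noty; apply: nuy.
    apply/tuple_uniqP => i j yij; apply/eqP/negPn/negP => ij; apply: noty.
    by exists (i, j) => //=; rewrite yij.
  move=> [[i j]] /= ij /eqP yij; apply/negP => /tuple_uniqP/(_ _ _ yij)/eqP.
  exact/negP.
apply: fin_bigcup_measurable => //.
move=> p _; rewrite -[X in measurable X]setTI.
apply: (@measurable_fun_eqr _ _ _ setT (fun y : n.-tuple RT => tnth y p.1 : R)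
  (fun y => tnth y p.2 : R) _ _ _ [set true]) => //; exact: measurable_tnth.
Qed.

(** Over a tail without repetitions, the first coordinate has only finitely many
    values that create one. *)
Lemma lebesgue_tuple_ties n : lebesgue_tuple R n (@ties n) = 0.
Proof.
elim: n => [|n IHn].
  rewrite (_ : @ties 0 = set0) ?measure0//; apply/seteqP; split => // y.
  by rewrite /ties /= tuple0.
have mt := @measurable_ties n.+1.
have mi : measurable_fun [set: n.+1.-tuple RT] (fun y => (\1_(@ties n.+1) y)%:E : \bar R).
  exact/measurable_EFinP.
rewrite -[in LHS](setIT (@ties n.+1)) -integral_indic//.
have mit : measurable_fun setT
    ((fun y => (\1_(@ties n.+1) y)%:E : \bar R) \o @tcons _ RT n).
  by apply: measurableT_comp => //; exact: measurable_tcons.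
have i0 y : 0 <= (\1_(@ties n.+1) y)%:E :> \bar R by rewrite lee_fin.
rewrite (ge0_integral_lebesgue_tupleS mi i0).
rewrite (fubini_tonelli2 _ mit (fun=> i0 _)).
have mG := measurable_fun_fubini_tonelli_G (m1 := mu) _ mit (fun=> i0 _).
rewrite (ge0_ae_eq_integral _ (g := cst 0))//; first by rewrite integral0.
  by move=> y _; apply: integral_ge0 => x _; exact: i0.
exists (@ties n); split => //; first exact: measurable_ties.
move=> y /=; apply: contra_notP => /negP; rewrite negbK => uy _.
rewrite /fubini_G.
rewrite (eq_integral (fun x => (\1_[set x : RT | x \in (y : seq R)] x)%:E)).
  have cy : countable [set x : RT | x \in (y : seq R)].
    exact/finite_set_countable/finite_seq.
  rewrite integral_indic// ?setIT; first exact: countable_lebesgue_measure0.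
  by apply: countable_measurable => // t; exact: measurable_set1.
move=> x _; congr (_%:E); rewrite !indicE; congr ((_ : bool)%:R).
by apply/idP/idP => /set_mem H; apply/mem_set; move: H;
  rewrite /ties /= uy andbT negbK.
Qed.

Definition cube n : set (n.-tuple RT) :=
  [set y | forall i, (0 <= (tnth y i : R) <= 1)%R].

Definition chamber n : set (n.-tuple RT) :=
  [set y | cube y /\ sorted (>=%R : rel R) y].

Lemma measurable_cube n : measurable (@cube n).
Proof.
have -> : @cube n = box (fun=> `[0%R, 1%R]%classic).
  by apply/seteqP; split => y + i => /(_ i); rewrite /= in_itv.
by apply: measurable_box.
Qed.

Lemma measurable_chamber n : measurable (@chamber n).
Proof.
have -> : @chamber n = @cube n `&` \bigcap_(p in [set p : 'I_n * 'I_n | (p.1 <= p.2)%N])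
    [set y : n.-tuple RT | ((tnth y p.2 : R) <= tnth y p.1)%R].
  apply/seteqP; split => y /= -[cy]; last first.
    by move=> ysort; split => //; apply/sorted_tnthP => i j ij; exact: (ysort (i, j)).
  by move=> /sorted_tnthP ysort; split => // -[i j] /=; exact: ysort.
apply: measurableI; first exact: measurable_cube.
apply: fin_bigcap_measurable => //.
move=> p _; rewrite -[X in measurable X]setTI.
apply: (@measurable_fun_ler _ _ _ setT (fun y : n.-tuple RT => tnth y p.2 : R)
  (fun y => tnth y p.1 : R) _ _ _ [set true]) => //; exact: measurable_tnth.
Qed.

(** Exactly one permutation sorts a tuple without repetitions, so the images of
    the chamber tile the cube up to [ties]. *)
Lemma sum_chamber n (y : n.-tuple RT) : ~ ties y ->
  (\sum_(s : 'S_n) \1_(@chamber n) (permv s y) = \1_(@cube n) y :> R)%R.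
Proof.
move=> /negP; rewrite negbK => uy.
have cubeE s : cube (permv s y) <-> cube y.
  split=> cy i; last by rewrite tnth_mktuple.
  by have := cy ((s^-1)%g i); rewrite tnth_mktuple permKV.
have [cy|ncy] := pselect (cube y); last first.
  rewrite big1 => [|s _]; first by rewrite indicE memNset.
  by rewrite indicE memNset// => -[/cubeE].
rewrite [RHS]indicE mem_set//.
have tot : total (>=%R : rel R) by move=> a b; exact: le_total.
have /tuple_permP[s0 s0E] : perm_eq (sort (>=%R : rel R) y) (y : seq R).
  exact/permPl/perm_sort.
have ss0 : sorted (>=%R : rel R) (permv s0 y).
  by rewrite /permv -s0E; exact: sort_sorted.
rewrite (bigD1 s0)//= indicE mem_set ?big1 ?addr0//; last by split => //; exact/cubeE.
move=> s ss; rewrite indicE memNset// => -[_ sorts]; move/eqP: ss; apply.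
have seqE : permv s y = permv s0 y.
  apply: val_inj; apply: (sorted_eq (leT := >=%R : rel R)) => //.
  - by move=> a b c ba cb; exact: le_trans ba.
  - by move=> a b /andP[ba ab]; apply: le_anti; apply/andP; split.
  - have P t : perm_eq (permv t y) y.
      by rewrite perm_sym; apply/tuple_permP; exists (t^-1)%g;
        congr val; apply: eq_from_tnth => i; rewrite !tnth_mktuple permKV.
    by apply: (perm_trans (P s)); rewrite perm_sym; exact: P.
apply/permP => i; apply: (tuple_uniqP _ uy).
by have := congr1 (fun t => tnth t i) seqE; rewrite !tnth_mktuple.
Qed.

Lemma ge0_integral_cube n (f : n.-tuple RT -> \bar R) :
  measurable_fun [set: n.-tuple RT] f -> (forall y, 0 <= f y) ->
  (forall s y, f (permv s y) = f y) ->
  \int[lebesgue_tuple R n]_(y in @cube n) f y =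
  n`!%:R%:E * \int[lebesgue_tuple R n]_(y in @chamber n) f y.
Proof.
move=> mf f0 fperm.
have m1 : measurable_fun [set: n.-tuple RT] (\1_(@chamber n) : _ -> R).
  by apply: measurable_indic; exact: measurable_chamber.
have m1s s : measurable_fun [set: n.-tuple RT] (fun y => \1_(@chamber n) (permv s y) : R).
  by apply: measurableT_comp => //; exact: measurable_permv.
have i0 (A : set (n.-tuple RT)) y : 0 <= (\1_A y)%:E :> \bar R by rewrite lee_fin.
rewrite [LHS]integral_mkcond [in RHS]integral_mkcond !epatch_indic.
transitivity (\int[lebesgue_tuple R n]_y
    \sum_(s : 'S_n) (f y * (\1_(@chamber n) (permv s y))%:E)).
  apply: ge0_ae_eq_integral => //.
  - apply: emeasurable_funM => //; apply/measurable_EFinP.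
    by apply: measurable_indic; exact: measurable_cube.
  - apply: emeasurable_sum => s; apply: emeasurable_funM => //.
    exact/measurable_EFinP.
  - by move=> y _; rewrite mule_ge0//=; exact: i0.
  - by move=> y _; apply: sume_ge0 => s _; rewrite mule_ge0//; exact: i0.
  exists (@ties n); split; [exact: measurable_ties|exact: lebesgue_tuple_ties|].
  move=> y /=; apply: contra_notP => ny _.
  by rewrite -ge0_sume_distrr => [|s _]; rewrite ?i0// sumEFin sum_chamber.
rewrite ge0_integral_sum//=; last 2 first.
- by move=> s; apply: emeasurable_funM => //; exact/measurable_EFinP.
- by move=> s y _; rewrite mule_ge0//; exact: i0.
under eq_bigr => s _ do under eq_integral => y _ do rewrite -(fperm s).
have E s : \int[lebesgue_tuple R n]_y
    (f (permv s y) * (\1_(@chamber n) (permv s y))%:E) =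
    \int[lebesgue_tuple R n]_y (f y * (\1_(@chamber n) y)%:E).
  apply: (ge0_integral_permv s (f := fun y => f y * (\1_(@chamber n) y)%:E)).
    by apply: emeasurable_funM => //; exact/measurable_EFinP.
  by move=> y; rewrite mule_ge0//; exact: i0.
under eq_bigr => s _ do rewrite E.
rewrite mule_natl -card_Sn; exact: sumr_const.
Qed.

End PermInvariance.

(** * Complex integrals of bounded measurable functions *)
Section BoundedMeasurable.
Context (R : realType) d (T : measurableType d).
Implicit Types (f g : T -> R) (F G : T -> R[i]).

(** This class is closed under the ring operations and integrable on every set of
    finite measure, so that linearity and Fubini's theorem apply to products of
    exponentials without further integrability conditions. *)
Definition bounded_meas f :=
  measurable_fun [set: T] f /\ exists M, forall x, `|f x| <= M.

Lemma bounded_meas_cst c : bounded_meas (fun=> c).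
Proof. by split => //; exists `|c|. Qed.

Lemma bounded_measD f g : bounded_meas f -> bounded_meas g ->
  bounded_meas (fun x => f x + g x).
Proof.
move=> [mf [M fM]] [mg [N gN]]; split; first exact: measurable_funD.
by exists (M + N) => x; rewrite (le_trans (ler_normD _ _))// lerD.
Qed.

Lemma bounded_measM f g : bounded_meas f -> bounded_meas g ->
  bounded_meas (fun x => f x * g x).
Proof.
move=> [mf [M fM]] [mg [N gN]]; split; first exact: measurable_funM.
by exists (M * N) => x; rewrite normrM ler_pM.
Qed.

Lemma bounded_measN f : bounded_meas f -> bounded_meas (fun x => - f x).
Proof.
move=> [mf [M fM]]; split; first exact: measurableT_comp.
by exists M => x; rewrite normrN.
Qed.

Lemma bounded_meas_integrable (mu : {measure set T -> \bar R}) A f :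
  measurable A -> (mu A < +oo)%E -> bounded_meas f ->
  mu.-integrable A (EFin \o f).
Proof.
move=> mA Afin [mf [M fM]]; apply: measurable_bounded_integrable => //.
  exact: measurable_funTS.
by exists M; split=> [|N MN x _]; [exact: num_real|exact/(le_trans (fM x))/ltW].
Qed.

Definition cbounded_meas F :=
  bounded_meas (fun x => complex.Re (F x)) /\
  bounded_meas (fun x => complex.Im (F x)).

Lemma cbounded_meas_cst c : cbounded_meas (fun=> c).
Proof. by split; exact: bounded_meas_cst. Qed.

Lemma cbounded_measD F G : cbounded_meas F -> cbounded_meas G ->
  cbounded_meas (fun x => F x + G x).
Proof.
move=> [rF iF] [rG iG]; split.
  rewrite (_ : (fun _ => _) = fun x => complex.Re (F x) + complex.Re (G x)).
    exact: bounded_measD.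
  by apply/funext => x; case: (F x); case: (G x).
rewrite (_ : (fun _ => _) = fun x => complex.Im (F x) + complex.Im (G x)).
  exact: bounded_measD.
by apply/funext => x; case: (F x); case: (G x).
Qed.

Lemma cbounded_measM F G : cbounded_meas F -> cbounded_meas G ->
  cbounded_meas (fun x => F x * G x).
Proof.
move=> [rF iF] [rG iG]; split.
  rewrite (_ : (fun _ => _) = fun x => complex.Re (F x) * complex.Re (G x) +
     - (complex.Im (F x) * complex.Im (G x))).
    by apply: bounded_measD; [|apply: bounded_measN]; exact: bounded_measM.
  by apply/funext => x; case: (F x); case: (G x).
rewrite (_ : (fun _ => _) = fun x => complex.Re (F x) * complex.Im (G x) +
   complex.Im (F x) * complex.Re (G x)).
  by apply: bounded_measD; exact: bounded_measM.
by apply/funext => x; case: (F x); case: (G x).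
Qed.

Lemma cbounded_meas_sum I (r : seq I) (P : pred I) (F : I -> T -> R[i]) :
  (forall i, P i -> cbounded_meas (F i)) ->
  cbounded_meas (fun x => \sum_(i <- r | P i) F i x).
Proof.
move=> bF; elim: r => [|i r IHr].
  rewrite (_ : (fun _ => _) = fun=> 0); first exact: cbounded_meas_cst.
  by apply/funext => x; rewrite big_nil.
rewrite (_ : (fun _ => _) = fun x => if P i then F i x + \sum_(j <- r | P j) F j x
    else \sum_(j <- r | P j) F j x); last first.
  by apply/funext => x; rewrite big_cons.
by case: (boolP (P i)) => // Pi; apply: cbounded_measD => //; exact: bF.
Qed.

Lemma cbounded_meas_prod I (r : seq I) (P : pred I) (F : I -> T -> R[i]) :
  (forall i, P i -> cbounded_meas (F i)) ->
  cbounded_meas (fun x => \prod_(i <- r | P i) F i x).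
Proof.
move=> bF; elim: r => [|i r IHr].
  rewrite (_ : (fun _ => _) = fun=> 1); first exact: cbounded_meas_cst.
  by apply/funext => x; rewrite big_nil.
rewrite (_ : (fun _ => _) = fun x => if P i then F i x * \prod_(j <- r | P j) F j x
    else \prod_(j <- r | P j) F j x); last first.
  by apply/funext => x; rewrite big_cons.
by case: (boolP (P i)) => // Pi; apply: cbounded_measM => //; exact: bF.
Qed.

Lemma cbounded_meas_expi f : measurable_fun [set: T] f ->
  cbounded_meas (fun x => expi (f x)).
Proof.
move=> mf; split; split => /=.
- apply: measurableT_comp mf; apply: continuous_measurable_fun.
  exact: continuous_cos.
- by exists 1 => x; rewrite ler_norml cos_geN1 cos_le1.
- apply: measurableT_comp mf; apply: continuous_measurable_fun.
  exact: continuous_sin.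
- by exists 1 => x; rewrite ler_norml sin_geN1 sin_le1.
Qed.

End BoundedMeasurable.

Lemma bounded_meas_comp (R : realType) d (T : measurableType d) d'
    (T' : measurableType d') (f : T -> R) (h : T' -> T) :
  measurable_fun [set: T'] h -> bounded_meas f -> bounded_meas (f \o h).
Proof.
by move=> mh [mf [M fM]]; split; [exact: measurableT_comp|exists M => x /=].
Qed.

Section ComplexIntegral.
Context (R : realType) d (T : measurableType d) (mu : {measure set T -> \bar R}).
Context (A : set T).
Hypotheses (mA : measurable A) (Afin : (mu A < +oo)%E).

(** With [mu] the surface measure and [B] the triangle, this is the unnormalized
    form of [mean_triangle]. *)
Definition cintegral (B : set T) (F : T -> R[i]) : R[i] :=
  (\int[mu]_(x in B) complex.Re (F x) +i* \int[mu]_(x in B) complex.Im (F x))%C.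

Let int f : bounded_meas f -> mu.-integrable A (EFin \o f).
Proof. exact: bounded_meas_integrable. Qed.

Lemma eq_cintegral F G : (forall x, A x -> F x = G x) ->
  cintegral A F = cintegral A G.
Proof.
by move=> FG; congr Complex; apply: eq_Rintegral => x /set_mem/FG ->.
Qed.

Lemma cintegralD F G : cbounded_meas F -> cbounded_meas G ->
  cintegral A (fun x => F x + G x) = cintegral A F + cintegral A G.
Proof.
move=> [rF iF] [rG iG]; rewrite /cintegral [RHS]/GRing.add /=; congr Complex.
  rewrite -RintegralD//; [|exact: int..].
  by apply: eq_Rintegral => x _; case: (F x); case: (G x).
rewrite -RintegralD//; [|exact: int..].
by apply: eq_Rintegral => x _; case: (F x); case: (G x).
Qed.

Lemma cintegralZ c F : cbounded_meas F ->
  cintegral A (fun x => c * F x) = c * cintegral A F.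
Proof.
move=> [rF iF]; case: c => a b; rewrite /cintegral [RHS]/GRing.mul /=.
congr Complex.
  rewrite -!RintegralZl//; [|exact: int..].
  rewrite -RintegralB//; [|apply: int; exact: bounded_measM (bounded_meas_cst _ _) _..].
  by apply: eq_Rintegral => x _; case: (F x).
rewrite -!RintegralZl//; [|exact: int..].
rewrite -RintegralD//; [|apply: int; exact: bounded_measM (bounded_meas_cst _ _) _..].
by apply: eq_Rintegral => x _; case: (F x).
Qed.

Lemma cintegral0 : cintegral A (fun=> 0) = 0.
Proof.
rewrite -[RHS](mul0r (cintegral A (fun=> 0))) -cintegralZ.
  by apply: eq_cintegral => x _; rewrite mulr0.
exact: cbounded_meas_cst.
Qed.

Lemma cintegral_sum I (r : seq I) (F : I -> T -> R[i]) :
  (forall i, cbounded_meas (F i)) ->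
  cintegral A (fun x => \sum_(i <- r) F i x) = \sum_(i <- r) cintegral A (F i).
Proof.
move=> bF; elim: r => [|i r IHr].
  rewrite big_nil -[RHS]cintegral0; apply: eq_cintegral => x _.
  by rewrite big_nil.
rewrite big_cons -IHr -cintegralD//; last exact: cbounded_meas_sum.
by apply: eq_cintegral => x _; rewrite big_cons.
Qed.

End ComplexIntegral.

(** * Products over the cube, and exponentials *)
Section CubeIntegral.
Context (R : realType).
Local Notation mu := (@lebesgue_measure R).
Local Notation RT := (measurableTypeR R).
Local Notation I01 := (`[0%R, 1%R]%classic : set RT).

Lemma lebesgue_tuple_cube n : lebesgue_tuple R n (@cube R n) = 1%E.
Proof.
rewrite (_ : @cube R n = box (fun=> I01)); last first.
  by apply/seteqP; split => y + i => /(_ i); rewrite /= in_itv.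
rewrite lebesgue_tuple_box// big1// => i _.
by rewrite lebesgue_measure_itv /= lte_fin ltr01 oppr0 adde0.
Qed.

Lemma preimage_tcons_cube n : @tcons _ RT n @^-1` @cube R n.+1 = I01 `*` @cube R n.
Proof.
apply/seteqP; split => -[x y] /=.
- move=> Axy; split => /=.
    by have := Axy ord0; rewrite tnth_tcons0 in_itv.
  by move=> i; have := Axy (lift ord0 i); rewrite tnth_tconsS.
- rewrite in_itv => -[/= Ax Ay] i; case: (unliftP ord0 i) => [j ->|->].
    by rewrite tnth_tconsS; exact: Ay.
  by rewrite tnth_tcons0.
Qed.

Lemma Rintegral_cubeS n (f : RT -> R) (g : n.-tuple RT -> R) :
  bounded_meas f -> bounded_meas g ->
  \int[lebesgue_tuple R n.+1]_(t in @cube R n.+1)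
    (f (tuncons t).1 * g (tuncons t).2) =
  (\int[mu]_(x in I01) f x) * (\int[lebesgue_tuple R n]_(y in @cube R n) g y).
Proof.
move=> bf bg.
have mC := @measurable_cube R n.
have mI : measurable I01 by [].
have muI : mu I01 = 1%E.
  by rewrite lebesgue_measure_itv /= lte_fin ltr01 oppr0 adde0.
have intf : mu.-integrable I01 (EFin \o f).
  by apply: bounded_meas_integrable => //; rewrite [ltLHS]muI ltry.
have intg : (lebesgue_tuple R n).-integrable (@cube R n) (EFin \o g).
  by apply: bounded_meas_integrable => //; rewrite [ltLHS]lebesgue_tuple_cube ltry.
pose h (t : n.+1.-tuple RT) := f (tuncons t).1 * g (tuncons t).2.
pose hp (p : RT * n.-tuple RT) := f p.1 * g p.2.
have htc p : h (tcons p) = hp p by rewrite /h tconsK.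
have bh : bounded_meas hp.
  apply: bounded_measM.
    exact: (bounded_meas_comp measurable_fst bf).
  exact: (bounded_meas_comp measurable_snd bg).
have mh : measurable_fun [set: n.+1.-tuple RT] h.
  have [mf _] := bf; have [mg _] := bg.
  have mu1 : measurable_fun [set: n.+1.-tuple RT] (fun t => (@tuncons _ RT n t).1).
    exact: (measurableT_comp measurable_fst (@measurable_tuncons _ RT n)).
  have mu2 : measurable_fun [set: n.+1.-tuple RT] (fun t => (@tuncons _ RT n t).2).
    exact: (measurableT_comp measurable_snd (@measurable_tuncons _ RT n)).
  apply: measurable_funM; first exact: (measurableT_comp mf mu1).
  exact: (measurableT_comp mg mu2).
have Afin : ((mu \x lebesgue_tuple R n)%E (I01 `*` @cube R n) < +oo)%E.
  rewrite product_measure1E//.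
  rewrite [ltLHS](_ : _ = (mu I01 * lebesgue_tuple R n (@cube R n))%E)//.
  by rewrite muI lebesgue_tuple_cube mule1 ltry.
have mA : measurable (I01 `*` @cube R n) by exact: measurableX.
have inth : (mu \x lebesgue_tuple R n)%E.-integrable (I01 `*` @cube R n) (EFin \o hp).
  exact: bounded_meas_integrable.
have E : (\int[lebesgue_tuple R n.+1]_(t in @cube R n.+1) (h t)%:E =
    \int[mu]_(x in I01) (f x)%:E * \int[lebesgue_tuple R n]_(y in @cube R n) (g y)%:E)%E.
  transitivity (\int[mu \x lebesgue_tuple R n]_(p in I01 `*` @cube R n) (hp p)%:E)%E.
    have ih : (mu \x lebesgue_tuple R n)%E.-integrable
        (@tcons _ RT n @^-1` @cube R n.+1) ((EFin \o h) \o @tcons _ RT n).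
      rewrite preimage_tcons_cube.
      by apply: eq_integrable inth => // p _; rewrite /= htc.
    have mhE : measurable_fun setT (EFin \o h) by exact/measurable_EFinP.
    have := integral_pushforward (@measurable_tcons _ RT n) mhE ih
      (@measurable_cube R n.+1).
    rewrite preimage_tcons_cube => E.
    apply: etrans (etrans E _); first by [].
    by apply: eq_integral => p _; rewrite /= htc.
  rewrite integral_mkcond -integral12_prod_meas1; last exact/(integrable_mkcond _ mA).
  transitivity (\int[mu]_x (((EFin \o f) \_ I01) x *
      \int[lebesgue_tuple R n]_(y in @cube R n) (g y)%:E))%E.
    apply: eq_integral => x _; rewrite /fubini_F.
    transitivity (\int[lebesgue_tuple R n]_y
        (((EFin \o f) \_ I01) x * ((EFin \o g) \_ (@cube R n)) y))%E.
      apply: eq_integral => y _; rewrite !patchE in_setX /=.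
      by case: ifPn => [/andP[-> ->]//|]; rewrite negb_and => /orP[] /negbTE ->;
         rewrite ?mul0e ?mule0.
    have [r ->] : exists r, ((EFin \o f) \_ I01) x = r%:E.
      by rewrite patchE; case: ifPn => _; [exists (f x)|exists 0].
    rewrite integralZl//; last exact/(integrable_mkcond _ mC).
    by rewrite [in RHS]integral_mkcond.
  have [r ->] : exists r, (\int[lebesgue_tuple R n]_(y in @cube R n) (g y)%:E = r%:E)%E.
    exists (fine (\int[lebesgue_tuple R n]_(y in @cube R n) (g y)%:E)%E).
    by rewrite fineK//; exact: integrable_fin_num.
  rewrite integralZr//; last exact/(integrable_mkcond _ mI).
  by rewrite [in RHS]integral_mkcond.
rewrite /Rintegral E fineM//; exact: integrable_fin_num.
Qed.

Local Notation cint := (cintegral mu I01).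
Local Notation ccube n := (cintegral (lebesgue_tuple R n) (@cube R n)).

Lemma cintegral_cubeS n (F : RT -> R[i]) (G : n.-tuple RT -> R[i]) :
  cbounded_meas F -> cbounded_meas G ->
  ccube n.+1 (fun t => F (tuncons t).1 * G (tuncons t).2) = cint F * ccube n G.
Proof.
move=> [rF iF] [rG iG].
have mulE (a b c e : R) : (Complex a b * Complex c e : R[i]) =
  Complex (a * c - b * e) (a * e + b * c) by [].
rewrite /cintegral mulE.
have mt := @measurable_tuncons _ RT n.
have mt1 : measurable_fun [set: n.+1.-tuple RT] (fun t => (@tuncons _ RT n t).1).
  exact: (measurableT_comp measurable_fst mt).
have mt2 : measurable_fun [set: n.+1.-tuple RT] (fun t => (@tuncons _ RT n t).2).
  exact: (measurableT_comp measurable_snd mt).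
have Cfin : (lebesgue_tuple R n.+1 (@cube R n.+1) < +oo)%E.
  by rewrite lebesgue_tuple_cube ltry.
have mC := @measurable_cube R n.+1.
have int (f : RT -> R) (g : n.-tuple RT -> R) : bounded_meas f -> bounded_meas g ->
    (lebesgue_tuple R n.+1).-integrable (@cube R n.+1)
      (EFin \o fun t => f (tuncons t).1 * g (tuncons t).2).
  move=> bf bg; apply: bounded_meas_integrable => //; apply: bounded_measM.
    exact: (bounded_meas_comp mt1 bf).
  exact: (bounded_meas_comp mt2 bg).
congr Complex.
  rewrite -!Rintegral_cubeS// -RintegralB//; last 2 first.
  - exact: (int _ _ rF rG).
  - exact: (int _ _ iF iG).
  by apply: eq_Rintegral => t _; case: (F _) => ? ?; case: (G _).
rewrite -!Rintegral_cubeS// -RintegralD//; last 2 first.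
- exact: (int _ _ rF iG).
- exact: (int _ _ iF rG).
by apply: eq_Rintegral => t _; case: (F _) => ? ?; case: (G _).
Qed.

Lemma cintegral_cube_prod n (F : 'I_n -> RT -> R[i]) :
  (forall i, cbounded_meas (F i)) ->
  ccube n (fun t => \prod_(i < n) F i (tnth t i)) = \prod_(i < n) cint (F i).
Proof.
elim: n F => [|n IHn] F bF.
  rewrite big_ord0 (@eq_cintegral _ _ _ _ _ _ (fun=> 1)); last first.
    by move=> t _; rewrite big_ord0.
  rewrite /cintegral !Rintegral_cst; [|exact: measurable_cube..].
  by rewrite mul0r mul1r [X in fine X]lebesgue_tuple_cube.
rewrite big_ord_recl -IHn; last by move=> i; exact: bF.
rewrite -cintegral_cubeS//; last first.
  apply: cbounded_meas_prod => i _; have [rF iF] := bF (lift ord0 i).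
  split; [exact: (bounded_meas_comp (measurable_tnth i) rF)|].
  exact: (bounded_meas_comp (measurable_tnth i) iF).
apply: eq_cintegral => t _; rewrite big_ord_recl; congr (_ * _).
apply: eq_bigr => i _; congr (F _ _).
by rewrite /tuncons /= !(tnth_nth 0) /= nth_behead.
Qed.

End CubeIntegral.

Section Expi.
Context (R : realType).
Implicit Types x y : R.

Lemma expi0 : expi 0 = 1 :> R[i].
Proof. by rewrite /expi cos0 sin0. Qed.

Lemma expiD x y : expi (x + y) = expi x * expi y.
Proof.
rewrite /expi cosD sinD [RHS]/GRing.mul /=; congr Complex; ring.
Qed.

Lemma expi_sum I (r : seq I) (P : pred I) (F : I -> R) :
  expi (\sum_(i <- r | P i) F i) = \prod_(i <- r | P i) expi (F i).
Proof. exact: (big_morph _ expiD expi0). Qed.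

Lemma expiMn x n : expi (x *+ n) = expi x ^+ n.
Proof.
by elim: n => [|n IHn]; rewrite ?mulr0n ?expi0// mulrS expiD IHn exprS.
Qed.

Lemma conjc_expi x : (expi x)^*%C = expi (- x).
Proof. by rewrite /expi cosN sinN. Qed.

Lemma expi2piz (m : int) : expi (2 * pi * m%:~R) = 1 :> R[i].
Proof.
have E (n : nat) : expi (2 * pi * n%:R) = 1 :> R[i].
  by rewrite mulr_natr expiMn /expi mulr_natl cos2pi sin2pi expr1n.
case: (intP m) => [|n|n]; first by rewrite mulr0 expi0.
  exact: E.
rewrite mulrNz mulrN -conjc_expi -[n.+1%:~R]/(n.+1%:R) E.
by rewrite /conjc /= oppr0.
Qed.

End Expi.

(** * Integrals and fractional values of exponentials *)
Section ExpiIntegral.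
Context (R : realType).
Local Notation mu := (@lebesgue_measure R).
Local Notation RT := (measurableTypeR R).
Local Notation I01 := (`[0%R, 1%R]%classic : set RT).

Lemma cos_mul_continuous (a : R) : continuous (fun x : R => cos (a * x)).
Proof.
move=> x; apply: continuous_comp; last exact: continuous_cos.
by apply: cvgM; [exact: cvg_cst|exact: cvg_id].
Qed.

Lemma sin_mul_continuous (a : R) : continuous (fun x : R => sin (a * x)).
Proof.
move=> x; apply: continuous_comp; last exact: continuous_sin.
by apply: cvgM; [exact: cvg_cst|exact: cvg_id].
Qed.

Lemma derive_LRcontinuous (F f : R -> R) : (forall x : R, is_derive x 1 F (f x)) ->
  derivable_oo_LRcontinuous F 0 1.
Proof.
move=> dF.
have cF : continuous F.
  by move=> x; apply/differentiable_continuous/derivable1_diffP.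
split; [by move=> x _| |].
- by apply: cvg_at_right_filter; exact: cF.
- by apply: cvg_at_left_filter; exact: cF.
Qed.

Lemma Rintegral_derive (F f : R -> R) : continuous f ->
  (forall x : R, is_derive x 1 F (f x)) -> \int[mu]_(x in I01) f x = F 1 - F 0.
Proof.
move=> cf dF; rewrite /Rintegral (@continuous_FTC2 _ f F 0 1)//.
- exact: continuous_subspaceT.
- exact: derive_LRcontinuous dF.
- by move=> x _; rewrite derive1E derive_val.
Qed.

(** The factor [sin a + i (1 - cos a)] is [- i (exp (i a) - 1)]: apart from
    [a^-1], the integral depends on [a] modulo [2 pi] only. *)
Lemma cintegral_expi (a : R) : a != 0 ->
  cintegral mu I01 (fun x => expi (a * x)) =
  (a^-1)%:C%C * (sin a +i* (1 - cos a))%C.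
Proof.
move=> a0.
have mulE (b c e : R) : (b%:C%C * Complex c e : R[i]) = Complex (b * c) (b * e).
  by rewrite /real_complex_def [LHS]/GRing.mul /= !mul0r subr0 addr0.
rewrite mulE; congr Complex => /=.
- have dF (x : R) : is_derive x 1 (fun x => a^-1 * sin (a * x)) (cos (a * x)).
    apply: is_derive_eq.
    by rewrite /GRing.scale /=; field.
  by rewrite (Rintegral_derive (@cos_mul_continuous a) dF) !mulr1 mulr0 sin0 mulr0 subr0.
- have dF (x : R) : is_derive x 1 (fun x => a^-1 * (1 - cos (a * x))) (sin (a * x)).
    apply: is_derive_eq.
    by rewrite /GRing.scale /=; field.
  rewrite (Rintegral_derive (@sin_mul_continuous a) dF).
  by rewrite !mulr1 mulr0 cos0 subrr mulr0 subr0.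
Qed.

Lemma cintegral_expi2piz (m : int) :
  cintegral mu I01 (fun x => expi (2 * pi * m%:~R * x)) = (m == 0)%:R.
Proof.
have [->|m0] := eqVneq m 0.
  rewrite /cintegral (@eq_Rintegral _ _ _ mu _ (fun=> 1)); last first.
    by move=> x _; rewrite mulr0 mul0r expi0.
  rewrite [X in Complex _ X](@eq_Rintegral _ _ _ mu _ (fun=> 0)); last first.
    by move=> x _; rewrite mulr0 mul0r expi0.
  rewrite !Rintegral_cst//= lebesgue_measure_itv /= lte_fin ltr01 /= oppr0 addr0.
  by rewrite mulr1 mul0r.
have p0 : (pi : R) != 0 by rewrite gt_eqF ?pi_gt0.
rewrite cintegral_expi; last by rewrite !mulf_neq0 ?intr_eq0 ?pnatr_eq0.
have := @expi2piz R m; rewrite /expi => -[-> ->].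
by rewrite subrr mulr0.
Qed.

Lemma expi_eq1 (x : R) : 0 <= x -> x < 2 * pi -> expi x = 1 -> x = 0.
Proof.
move=> x0 x2 [] cosx _; have p0 := pi_gt0 R.
have [xpi|pix] := leP x pi.
  by apply: cos_inj; rewrite ?cos0// in_itv /= ?x0 ?xpi ?lexx ?ltW.
have : 2 * pi - x = 0.
  apply: cos_inj.
  - by rewrite in_itv /=; apply/andP; split; lra.
  - by rewrite in_itv /= lexx ltW.
  - by rewrite cosB mulr_natl cos2pi sin2pi cosx cos0; ring.
by lra.
Qed.

(** Euclidean division reduces the exponent to the interval from [0] to [2 pi],
    where injectivity of the cosine on half a period decides. *)
Lemma expi_frac_eq1 (n : nat) (m : int) : (0 < n)%N ->
  (expi (2 * pi * (m%:~R / n%:R)) == 1 :> R[i]) = (n%:Z %| m)%Z.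
Proof.
move=> n0; have nR : (n%:R : R) != 0 by rewrite pnatr_eq0 -lt0n.
have nZ : n%:Z != 0 by rewrite eqz_nat -lt0n.
apply/eqP/idP => [|/dvdzP[q ->]]; last first.
  by rewrite intrM -pmulrn mulfK// expi2piz.
have mE : m%:~R / n%:R = (m %/ n)%Z%:~R + (m %% n)%Z%:~R / n%:R :> R.
  by rewrite {1}(divz_eq m n) intrD intrM -[n%:Z%:~R]/(n%:R) mulrDl mulfK.
rewrite mE mulrDr expiD expi2piz.
rewrite mul1r => /expi_eq1.
have r0 : 0 <= (m %% n)%Z by exact: modz_ge0.
have rn : (m %% n)%Z < n%:Z by apply: ltz_pmod.
have p0 := pi_gt0 R.
move=> H; have /eqP : 2 * pi * ((m %% n)%Z%:~R / n%:R) = 0 :> R.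
  apply: H.
    by rewrite mulr_ge0 ?divr_ge0// ?ler0z// mulr_ge0// ltW.
  rewrite -[ltRHS]mulr1 ltr_pM2l ?mulr_gt0// ltr_pdivrMr ?ltr0n// mul1r.
  by rewrite pmulrn ltr_int.
rewrite !mulf_eq0 invr_eq0 (negPf nR) (gt_eqF p0) !pnatr_eq0 /= orbF intr_eq0 => /eqP r00.
by apply/dvdz_mod0P.
Qed.

End ExpiIntegral.

(** * From the triangle to the cube *)
Section TriangleIntegral.
Context (R : realType) (d : nat).
Local Notation RT := (measurableTypeR R).
Local Notation lambdad := (lebesgue_tuple R d).

Lemma tnth_graph_widen (u : d.-tuple R) (i : 'I_d) :
  tnth (hyperplane_graph u) (widen_ord (leqnSn d) i) = tnth u i.
Proof. by rewrite !(tnth_nth 0) /= nth_rcons size_tuple ltn_ord. Qed.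

Lemma tnth_graph_max (u : d.-tuple R) :
  tnth (hyperplane_graph u) ord_max = - \sum_(i < d) tnth u i.
Proof. by rewrite !(tnth_nth 0) /= nth_rcons size_tuple ltnn eqxx. Qed.

Lemma ord_maxP (i : 'I_d.+1) :
  i = ord_max \/ exists j : 'I_d, i = widen_ord (leqnSn d) j.
Proof.
have [id_|di] := ltnP i d; last first.
  by left; apply: val_inj; apply/eqP; rewrite eqn_leq di -ltnS ltn_ord.
by right; exists (Ordinal id_); apply: val_inj.
Qed.

(** In the coordinates [y_i = t_i - t_{d+1}] the triangle is the set where
    [1 >= y_1 >= ... >= y_d >= 0]. *)
Lemma preimage_graph_triangleH :
  @hyperplane_graph R d @^-1` @triangleH R d = shear 1 0 @^-1` @chamber R d.
Proof.
have sE (u : d.-tuple RT) i : tnth (shear 1 0 u) i =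
    tnth (hyperplane_graph u) (widen_ord (leqnSn d) i) -
    tnth (hyperplane_graph u) ord_max.
  by rewrite tnth_mktuple tnth_graph_widen tnth_graph_max opprK mul1r addr0.
apply/seteqP; split => u /=.
- move=> [_ ut]; have cu : cube (shear 1 0 u).
    by move=> i; rewrite sE; apply: ut => /=.
  split => //; apply/sorted_tnthP => i j; rewrite leq_eqVlt => /orP[/eqP ij|ij].
    by rewrite (_ : i = j)//; exact: val_inj.
  rewrite !sE lerD2r -subr_ge0.
  by have /andP[] := ut (widen_ord (leqnSn d) i) (widen_ord (leqnSn d) j) ij.
- move=> [cu /sorted_tnthP ysort]; split; first exact: hyperplane_graphP.
  move=> i j ij; case: (ord_maxP i) => [ii|[i' ii]].
    by move: ij; rewrite ii ltnNge -ltnS ltn_ord.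
  rewrite {}ii in ij *.
  case: (ord_maxP j) => [->|[j' jj]]; first by rewrite -sE.
  rewrite {}jj in ij *.
  have -> : tnth (hyperplane_graph u) (widen_ord (leqnSn d) i') -
      tnth (hyperplane_graph u) (widen_ord (leqnSn d) j') =
      tnth (shear 1 0 u) i' - tnth (shear 1 0 u) j' by rewrite !sE; ring.
  have := ysort i' j' (ltnW ij); have /andP[] := cu i'; have /andP[] := cu j'.
  move: (tnth (shear 1 0 u) i' : R) (tnth (shear 1 0 u) j' : R) => a b.
  by move=> *; apply/andP; split; lra.
Qed.

Lemma measurable_triangleH : measurable (@triangleH R d : set (d.+1.-tuple RT)).
Proof.
have -> : @triangleH R d = [set t : d.+1.-tuple RT | \sum_(i < d.+1) (tnth t i : R) = 0] `&`
  \bigcap_(p in [set p : 'I_d.+1 * 'I_d.+1 | (p.1 < p.2)%N])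
    ([set t : d.+1.-tuple RT | 0 <= (tnth t p.1 : R) - tnth t p.2] `&`
     [set t : d.+1.-tuple RT | (tnth t p.1 : R) - tnth t p.2 <= 1]).
  apply/seteqP; split => t /= -[t0 tij]; split => //.
    by move=> -[i j] /= ij; apply/andP; exact: tij.
  by move=> i j ij; apply/andP; exact: (tij (i, j) ij).
have mt i : measurable_fun [set: d.+1.-tuple RT] (fun t => tnth t i : R).
  exact: measurable_tnth.
apply: measurableI.
  rewrite [X in measurable X](_ : _ =
      (fun t : d.+1.-tuple RT => \sum_(i < d.+1) (tnth t i : R)) @^-1` [set 0])//.
  rewrite -[X in measurable X]setTI.
  have ms : measurable_fun [set: d.+1.-tuple RT]
      (fun t => \sum_(i < d.+1) (tnth t i : R)) by exact: measurable_sum.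
  by apply: ms => //; exact: measurable_set1.
apply: fin_bigcap_measurable => // p _.
apply: measurableI; rewrite -[X in measurable X]setTI.
  apply: (@measurable_fun_ler _ _ _ setT (fun=> 0)
    (fun t : d.+1.-tuple RT => (tnth t p.1 : R) - tnth t p.2) _ _ _ [set true]) => //.
  exact: measurable_funB.
apply: (@measurable_fun_ler _ _ _ setT 
  (fun t : d.+1.-tuple RT => (tnth t p.1 : R) - tnth t p.2) (fun=> 1) _ _ _ [set true]) => //.
exact: measurable_funB.
Qed.

(** The area of the triangle: [Num.sqrt d.+1] is the area factor of the graph,
    [d.+1] the Jacobian of the shear, and [d`!] the number of chambers that tile
    the unit cube. *)
Definition triangle_factor : R := Num.sqrt d.+1%:R * ((d.+1)%:R^-1 * (d`!%:R)^-1).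

Lemma triangle_factor_gt0 : 0 < triangle_factor.
Proof.
by rewrite !mulr_gt0 ?sqrtr_gt0 ?invr_gt0 ?ltr0n// fact_gt0.
Qed.

Lemma ge0_integral_triangleH (F : d.+1.-tuple RT -> \bar R) (G : d.-tuple RT -> \bar R) :
  measurable_fun [set: d.+1.-tuple RT] F -> (forall t, 0 <= F t)%E ->
  measurable_fun [set: d.-tuple RT] G -> (forall y, 0 <= G y)%E ->
  (forall u, F (hyperplane_graph u) = G (shear 1 0 u)) ->
  (forall s y, G (permv s y) = G y) ->
  (\int[@surface R d]_(t in @triangleH R d) F t =
   triangle_factor%:E * \int[lambdad]_(y in @cube R d) G y)%E.
Proof.
move=> mF F0 mG G0 FG Gperm; have mD := measurable_triangleH.
rewrite [LHS](@ge0_integral_mscale _ _ _ _ _ mD)//; last exact: measurable_funTS.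
rewrite (_ : (\int[@graph_measure R d]_(x in triangleH (d:=d)) F x)%E =
  (\int[lambdad]_(u in @hyperplane_graph R d @^-1` @triangleH R d)
     (F \o @hyperplane_graph R d) u)%E); last first.
  apply: (ge0_integral_pushforward (@measurable_hyperplane_graph R d)) => //.
  exact: measurable_funTS.
rewrite preimage_graph_triangleH integral_mkcond epatch_indic.
have m1 : measurable_fun [set: d.-tuple RT] (fun y => G y * (\1_(@chamber R d) y)%:E)%E.
  apply: emeasurable_funM => //; apply/measurable_EFinP; apply: measurable_indic.
  exact: measurable_chamber.
have g0 y : (0 <= G y * (\1_(@chamber R d) y)%:E)%E.
  by rewrite mule_ge0// lee_fin.
rewrite (eq_integral (fun u => (fun y => G y * (\1_(@chamber R d) y)%:E)%E (shear 1 0 u))); last first.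
  by move=> u _ /=; rewrite FG.
rewrite (ge0_integral_shear 0 ler01 m1 g0) mulr1 nat1r.
rewrite ge0_integral_cube// [in RHS]integral_mkcond epatch_indic !muleA -!EFinM.
congr ((_%:E) * _)%E; rewrite /triangle_factor /=.
by rewrite -!mulrA mulVf ?mulr1// pnatr_eq0 -lt0n fact_gt0.
Qed.

Lemma surface_triangleH : @surface R d (@triangleH R d) = triangle_factor%:E.
Proof.
transitivity (\int[@surface R d]_(t in @triangleH R d) (cst 1 t))%E.
  by rewrite integral_cst ?mul1e//; exact: measurable_triangleH.
rewrite (@ge0_integral_triangleH (cst 1%E) (cst 1%E))//.
rewrite integral_cst; last exact: measurable_cube.
by rewrite mul1e [X in (_ * X)%E]lebesgue_tuple_cube mule1.
Qed.

(** Adding a large constant reduces the claim to nonnegative functions. *)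
Lemma Rintegral_triangleH (F : d.+1.-tuple RT -> R) (G : d.-tuple RT -> R) :
  bounded_meas F -> bounded_meas G ->
  (forall u, F (hyperplane_graph u) = G (shear 1 0 u)) ->
  (forall s y, G (permv s y) = G y) ->
  \int[@surface R d]_(t in @triangleH R d) F t =
  triangle_factor * \int[lambdad]_(y in @cube R d) G y.
Proof.
move=> bF bG FG Gperm; have [mF [M FM]] := bF; have [mG [N GN]] := bG.
pose K := Num.max M N.
have mD := measurable_triangleH; have mC := @measurable_cube R d.
have Dfin : (@surface R d (@triangleH R d) < +oo)%E by rewrite [ltLHS]surface_triangleH ltry.
have Cfin : (lambdad (@cube R d) < +oo)%E by rewrite [ltLHS]lebesgue_tuple_cube ltry.
have := @ge0_integral_triangleH (EFin \o fun t => F t + K) (EFin \o fun y => G y + K).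
have bFK : bounded_meas (fun t => F t + K).
  by apply: bounded_measD => //; exact: bounded_meas_cst.
have bGK : bounded_meas (fun t => G t + K).
  by apply: bounded_measD => //; exact: bounded_meas_cst.
move=> H; have {}H : \int[@surface R d]_(t in @triangleH R d) (F t + K) =
    triangle_factor * \int[lambdad]_(y in @cube R d) (G y + K).
  rewrite /Rintegral H => //.
  - rewrite fineM//.
    by apply: integrable_fin_num => //; exact: bounded_meas_integrable.
  - by apply/measurable_EFinP; exact: bFK.1.
  - move=> t; rewrite lee_fin -lerBlDr sub0r; have := FM t; rewrite ler_norml => /andP[].
    by move=> + _; apply: le_trans; rewrite lerN2 le_max lexx.
  - by apply/measurable_EFinP; exact: bGK.1.
  - move=> t; rewrite lee_fin -lerBlDr sub0r; have := GN t; rewrite ler_norml => /andP[].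
    by move=> + _; apply: le_trans; rewrite lerN2 le_max lexx orbT.
  - by move=> u /=; rewrite FG.
  - by move=> s y /=; rewrite Gperm.
move: H; rewrite !RintegralD//; try exact: bounded_meas_integrable.
- rewrite !Rintegral_cst// [X in fine X]surface_triangleH [X in _ = _ * (_ + K * fine X)]lebesgue_tuple_cube /=.
  by rewrite mulrDr mulr1 [K * _]mulrC => /addIr.
- by apply: bounded_meas_integrable => //; exact: bounded_meas_cst.
- by apply: bounded_meas_integrable => //; exact: bounded_meas_cst.
Qed.

End TriangleIntegral.

(** * The mean of a generalized cosine over the triangle *)
Section MeanTC.
Context (R : realType) (d : nat).
Local Notation RT := (measurableTypeR R).
Local Notation mu := (@lebesgue_measure R).
Local Notation I01 := (`[0%R, 1%R]%classic : set RT).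
Implicit Types (k : d.+1.-tuple int).

Let w := widen_ord (leqnSn d).

Lemma TC_permE k (t : d.+1.-tuple R) :
  TC k t = ((d.+1)`!%:R)^-1 * \sum_(s : 'S_d.+1)
    expi (2 * pi / d.+1%:R * \sum_(i < d.+1) (tnth k (s i))%:~R * tnth t i).
Proof.
rewrite /TC; congr (_ * _); rewrite (reindex_inj (@invg_inj 'S_d.+1)) /=.
apply: eq_bigr => s _; rewrite /phi; congr (expi (_ * _)).
rewrite (reindex_inj (@perm_inj _ s)) /=; apply: eq_bigr => i _.
by rewrite tnth_mktuple permK.
Qed.

(** [TC k] in the coordinates [y_i = t_i - t_{d+1}] of the chamber.  As the
    entries of [k] sum to zero, the scalar product of [k] with [t] only involves
    these differences. *)
Definition TCchamber k (y : d.-tuple RT) : R[i] :=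
  ((d.+1)`!%:R)^-1 * \sum_(s : 'S_d.+1)
    \prod_(i < d) expi (2 * pi * ((tnth k (s (w i)))%:~R / d.+1%:R) * (tnth y i : R)).

Lemma TC_graph k (u : d.-tuple R) : \sum_(i < d.+1) tnth k i = 0 ->
  TC k (hyperplane_graph u) = TCchamber k (shear 1 0 u).
Proof.
move=> k0; rewrite TC_permE; congr (_ * _); apply: eq_bigr => s _.
rewrite -expi_sum; congr expi.
have ks0 : \sum_(i < d.+1) (tnth k (s i))%:~R = 0 :> R.
  by rewrite (sum_reindex_perm s (fun i => (tnth k i)%:~R)) -rmorph_sum /= k0.
rewrite big_ord_recr /=; move: ks0; rewrite big_ord_recr /= => /eqP.
rewrite addrC addr_eq0 => /eqP ->.
rewrite tnth_graph_max mulrNN mulr_suml -big_split mulr_sumr /=.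
apply: eq_bigr => i _; rewrite -/w tnth_graph_widen tnth_mktuple mul1r addr0.
by ring.
Qed.

(** A permutation of the first [d] coordinates extends to all [d.+1] of them by
    fixing the last one, which only reorders the sum over the symmetric group. *)
Lemma TCchamber_perm k (s : 'S_d) y : TCchamber k (permv s y) = TCchamber k y.
Proof.
congr (_ * _); pose s' := lift_perm ord_max ord_max s.
have s'w i : s' (w i) = w (s i).
  have wl j : w j = lift ord_max j by apply: val_inj; exact: (esym (lift_max j)).
  by rewrite !wl lift_perm_lift.
rewrite (reindex_inj (@mulgI 'S_d.+1 s')) /=; apply: eq_bigr => r _.
rewrite [RHS](reindex_inj (@perm_inj _ s)) /=; apply: eq_bigr => i _.
by rewrite tnth_mktuple permM s'w.
Qed.

Lemma cbounded_meas_TCchamber k : cbounded_meas (TCchamber k).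
Proof.
apply: cbounded_measM; first exact: cbounded_meas_cst.
apply: cbounded_meas_sum => s _; apply: cbounded_meas_prod => i _.
apply: cbounded_meas_expi; apply: measurable_funM => //.
exact: measurable_tnth.
Qed.

Lemma cbounded_meas_TC k : cbounded_meas (TC k : d.+1.-tuple RT -> R[i]).
Proof.
rewrite [TC k](funext (@TC_permE k)).
apply: cbounded_measM; first exact: cbounded_meas_cst.
apply: cbounded_meas_sum => s _.
apply: cbounded_meas_expi; apply: measurable_funM => //.
apply: measurable_sum => i; apply: measurable_funM => //.
exact: measurable_tnth.
Qed.

Lemma cintegral_TCchamber k :
  cintegral (lebesgue_tuple R d) (@cube R d) (TCchamber k) =
  ((d.+1)`!%:R)^-1 * \sum_(s : 'S_d.+1) \prod_(i < d)
    cintegral mu I01 (fun x => expi (2 * pi * ((tnth k (s (w i)))%:~R / d.+1%:R) * x)).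
Proof.
have mC := @measurable_cube R d.
have Cfin : (lebesgue_tuple R d (@cube R d) < +oo)%E.
  by rewrite [ltLHS]lebesgue_tuple_cube ltry.
have be a : cbounded_meas (fun x : RT => expi (a * (x : R)) : R[i]).
  by apply: cbounded_meas_expi; apply: measurable_funM.
have bp s : cbounded_meas (fun y : d.-tuple RT => \prod_(i < d)
    expi (2 * pi * ((tnth k (s (w i)))%:~R / d.+1%:R) * (tnth y i : R)) : R[i]).
  apply: cbounded_meas_prod => i _.
  by apply: cbounded_meas_expi; apply: measurable_funM => //; exact: measurable_tnth.
rewrite cintegralZ//; last exact: cbounded_meas_sum.
rewrite cintegral_sum//; congr (_ * _); apply: eq_bigr => s _.
exact: cintegral_cube_prod.
Qed.

Lemma sum_perm_tnth k (i : 'I_d.+1) : \sum_(i < d.+1) tnth k i = 0 ->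
  \sum_(s : 'S_d.+1) tnth k (s i) = 0.
Proof.
move=> k0.
have E j : \sum_(s : 'S_d.+1) tnth k (s j) = \sum_(s : 'S_d.+1) tnth k (s i).
  rewrite [RHS](reindex_inj (@mulgI 'S_d.+1 (tperm i j))) /=.
  by apply: eq_bigr => s _; rewrite permM tpermL.
have : \sum_(j < d.+1) \sum_(s : 'S_d.+1) tnth k (s j) = 0.
  rewrite exchange_big big1 // => s _.
  by rewrite (sum_reindex_perm s (tnth k)).
rewrite (eq_bigr _ (fun j _ => E j)) sumr_const card_ord => /eqP.
by rewrite mulrn_eq0 /= => /eqP.
Qed.

(** The integral is a sum over permutations [s] of the products of the
    one-dimensional integrals [E (k (s i))] for [i < d], where [E m] is the
    integral of [exp (2 pi i m x / (d+1))] over the unit interval.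
    If [d.+1] divides the entries of [k], then [E] vanishes on the nonzero ones,
    and at least one of the [d] factors is of this kind: if the only nonzero
    entry were [k (s ord_max)], the sum of the entries would not be zero.
    Otherwise the entries are congruent to each other and nonzero, so [E m] is
    [W / m] for a constant [W], and the product for [s] is a constant times the
    omitted entry [k (s ord_max)].  These sum to zero over [s]. *)
Lemma cintegral_TCchamber_eq0 k : latticeH k -> (exists i, tnth k i != 0) ->
  cintegral (lebesgue_tuple R d) (@cube R d) (TCchamber k) = 0.
Proof.
move=> [k0 kmod] [i0 ki0]; rewrite cintegral_TCchamber.
have d0 : (d.+1%:R : R) != 0 by rewrite pnatr_eq0.
suff -> : \sum_(s : 'S_d.+1) \prod_(i < d) cintegral mu I01
    (fun x => expi (2 * pi * ((tnth k (s (w i)))%:~R / d.+1%:R) * x)) = 0.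
  by rewrite mulr0.
have [kdvd|kndvd] := boolP (d.+1%:Z %| tnth k ord0)%Z.
  have kd i : exists m : int, tnth k i = m * d.+1%:Z.
    apply/dvdzP; rewrite dvdzE -/(dvdz _ _); apply/dvdz_mod0P.
    by rewrite (kmod i ord0); apply/dvdz_mod0P.
  rewrite big1 // => s _.
  have [i si] : exists i, tnth k (s (w i)) != 0.
    apply: contrapT => nk; move/eqP: ki0; apply.
    have kw i : tnth k (s (w i)) = 0.
      by apply/eqP/negPn/negP => ?; apply: nk; exists i.
    have kmax : tnth k (s ord_max) = 0.
      move: k0; rewrite -(sum_reindex_perm s) big_ord_recr /=.
      by rewrite big1 ?add0r.
    rewrite -(permKV s i0); case: (ord_maxP ((s^-1)%g i0)) => [->//|[j ->]].
    exact: kw.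
  rewrite (bigD1 i) //=; have [m km] := kd (s (w i)).
  have m0 : m != 0 by apply: contraNneq si => m0; rewrite km m0 mul0r.
  rewrite (_ : (fun x : RT => _) = fun x : RT => expi (2 * pi * m%:~R * (x : R))).
    by rewrite cintegral_expi2piz (negPf m0) mul0r.
  by apply/funext => x; rewrite km intrM -[d.+1%:Z%:~R]/(d.+1%:R) mulfK.
have kneq0 i : tnth k i != 0.
  apply: contraNneq kndvd => ki; apply/dvdz_mod0P.
  by rewrite (kmod ord0 i) ki mod0z.
pose a i : R := 2 * pi * ((tnth k i)%:~R / d.+1%:R).
have ea i : expi (a i) = expi (a ord0) :> R[i].
  have /dvdzP[m km] : (d.+1%:Z %| tnth k i - tnth k ord0)%Z.
    by rewrite -eqz_mod_dvd; apply/eqP; exact: kmod.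
  have -> : a i = 2 * pi * m%:~R + a ord0.
    rewrite /a; have -> : tnth k i = m * d.+1%:Z + tnth k ord0 by rewrite -km subrK.
    by rewrite intrD intrM -[d.+1%:Z%:~R]/(d.+1%:R); field.
  by rewrite expiD expi2piz mul1r.
pose W : R[i] := (sin (a ord0) +i* (1 - cos (a ord0)))%C * (d.+1%:R / (2 * pi))%:C%C.
have p0 : (pi : R) != 0 by rewrite gt_eqF ?pi_gt0.
have a0 i : a i != 0.
  by rewrite !mulf_neq0 ?invr_eq0 ?intr_eq0 ?pnatr_eq0 ?kneq0.
have E i : cintegral mu I01 (fun x => expi (a i * x)) = W * ((tnth k i)%:~R)^-1.
  rewrite cintegral_expi//; have := ea i; rewrite /expi => -[-> ->].
  rewrite /W -mulrA [LHS]mulrC; congr (_ * _).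
  rewrite -(rmorph_int (real_complex R)) -fmorphV -rmorphM; congr (_%:C%C).
  have kR : (tnth k i)%:~R != 0 :> R by rewrite intr_eq0.
  rewrite /a; move: kR p0 d0.
  move: ((tnth k i)%:~R : R) (pi : R) (d.+1%:R : R) => x p y x0 p0 y0.
  by field; rewrite x0 p0 y0.
rewrite (eq_bigr (fun s : 'S_d.+1 => W ^+ d * (\prod_(i < d.+1) (tnth k i)%:~R)^-1 *
    (tnth k (s ord_max))%:~R)); last first.
  move=> s _; rewrite (eq_bigr _ (fun i _ => E (s (w i)))) big_split /=.
  rewrite prodr_const card_ord -mulrA; congr (_ * _).
  rewrite (reindex_inj (@perm_inj _ s)) /= big_ord_recr /= prodfV.
  by rewrite invfM mulfVK // intr_eq0.
by rewrite -mulr_sumr -rmorph_sum /= sum_perm_tnth// mulr0.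
Qed.

Lemma mean_triangleE (f : d.+1.-tuple R -> R[i]) :
  mean_triangle f = (triangle_factor R d)^-1%:C%C *
    cintegral (@surface R d) (@triangleH R d) f.
Proof. by rewrite /mean_triangle [X in fine X]surface_triangleH. Qed.

Lemma mean_triangle_TC k : latticeH k ->
  mean_triangle (TC k : d.+1.-tuple R -> R[i]) = [forall i, tnth k i == 0]%:R.
Proof.
move=> kH; have [k0 kmod] := kH; rewrite mean_triangleE.
have [rT iT] := cbounded_meas_TC k; have [rC iC] := cbounded_meas_TCchamber k.
have F0 : triangle_factor R d != 0 by rewrite gt_eqF ?triangle_factor_gt0.
case: (boolP [forall i, tnth k i == 0]) => [/forallP kall|].
  have TC1 t : TC k t = 1 :> R[i].
    rewrite /TC (eq_bigr (fun=> 1)); last first.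
      move=> s _; rewrite /phi big1 ?mulr0 ?expi0// => i _.
      by rewrite (eqP (kall i)) mul0r.
    by rewrite sumr_const card_Sn mulVf// pnatr_eq0 -lt0n fact_gt0.
  rewrite (@eq_cintegral _ _ _ _ _ _ (fun=> 1))//.
  rewrite /cintegral !Rintegral_cst; [|exact: measurable_triangleH..].
  rewrite mul1r mul0r [X in fine X]surface_triangleH.
  by rewrite -[Complex _ _]/((_)%:C%C) -rmorphM /= mulVf.
rewrite negb_forall => kex.
have knz : exists i, tnth k i != 0 by apply/existsP.
have := cintegral_TCchamber_eq0 kH knz; rewrite /cintegral => -[re im].
rewrite (_ : Complex _ _ = 0) ?mulr0//.
rewrite (Rintegral_triangleH rT rC)//; last 2 first.
- by move=> u; rewrite TC_graph.
- by move=> s y; rewrite TCchamber_perm.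
rewrite (Rintegral_triangleH iT iC)//; last 2 first.
- by move=> u; rewrite TC_graph.
- by move=> s y; rewrite TCchamber_perm.
by rewrite re im !mulr0.
Qed.

End MeanTC.

(** * Counting rearrangements *)
Section Rearrangements.
Local Open Scope nat_scope.
Variable T : eqType.

Lemma prod_count_fact_sub (s u : seq T) : {subset s <= u} -> uniq u ->
  \prod_(v <- undup s) (count_mem v s)`! = \prod_(v <- u) (count_mem v s)`!.
Proof.
move=> su uu; rewrite [RHS](bigID (mem s)) /= [X in _ = _ * X]big1 ?muln1.
  rewrite -[in RHS]big_filter; apply: perm_big; apply: uniq_perm.
  - exact: undup_uniq.
  - exact: filter_uniq.
  - move=> v; rewrite mem_undup mem_filter /=.
    by apply/idP/andP => [vs|[]//]; split => //; exact: su.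
by move=> v vs; rewrite (count_memPn vs).
Qed.

(** Induction on the size: after the choice of a first entry [v], removing it
    divides the product of factorials by the multiplicity of [v], and these
    multiplicities sum to the size. *)
Lemma multinomial_permutations (s : seq T) :
  size (permutations s) * \prod_(v <- undup s) (count_mem v s)`! = (size s)`!.
Proof.
move Dn: (size s) => n; elim: n s Dn => [|n IHn] s Dn.
  by rewrite (size0nil Dn) /= big_nil.
rewrite (perm_size (permutationsE _)) ?Dn// size_allpairs_dep sumnE big_map.
rewrite big_distrl /=.
rewrite (eq_big_seq (fun v => count_mem v s * n`!)); last first.
  move=> v; rewrite mem_undup => vs.
  have sr : size (rem v s) = n by rewrite size_rem// Dn.
  rewrite -(IHn _ sr) (prod_count_fact_sub (u := undup s)) ?undup_uniq//; last first.
    by move=> x /mem_rem; rewrite mem_undup.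
  rewrite mulnCA; congr (_ * _).
  have vu : v \in undup s by rewrite mem_undup.
  rewrite !(bigD1_seq v)//= ?undup_uniq// mulnA; congr (_ * _); last first.
    by apply: eq_bigr => x xv; rewrite count_mem_rem eq_sym (negPf xv) subn0.
  have : 0 < count_mem v s by rewrite -has_count has_pred1.
  by rewrite count_mem_rem eqxx subn1; case: (count_mem v s) => // m _; rewrite factS.
rewrite -big_distrl /= factS -Dn; congr (_ * _).
rewrite -[RHS](perm_size (perm_count_undup s)) size_flatten sumnE /shape.
by rewrite !big_map; apply: eq_bigr => v _; rewrite size_nseq.
Qed.

End Rearrangements.

Lemma prod_count_fact_map (T T' : eqType) (f : T -> T') (s : seq T) :
  {in s &, injective f} ->
  (\prod_(v <- undup (map f s)) (count_mem v (map f s))`! =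
   \prod_(v <- undup s) (count_mem v s)`!)%N.
Proof.
move=> finj; rewrite (perm_big (map f (undup s))) /=; last first.
  apply: uniq_perm; first exact: undup_uniq.
    rewrite map_inj_in_uniq ?undup_uniq// => x y.
    by rewrite !mem_undup; exact: finj.
  move=> v; rewrite mem_undup; apply/mapP/mapP => -[x xs ->]; exists x => //.
    by rewrite mem_undup.
  by rewrite -mem_undup.
rewrite big_map; apply: eq_big_seq => v; rewrite mem_undup => vs.
rewrite count_map; congr _`!; apply: eq_in_count => x xs /=.
by apply/eqP/eqP => [|->//]; exact: finj.
Qed.

Section Stabilizer.
Variables (T : eqType) (n : nat).
Implicit Types x t : n.-tuple T.

Lemma card_permv_eq x (r : 'S_n) :
  #|[pred s : 'S_n | permv s x == permv r x]| = #|[pred s : 'S_n | permv s x == x]|.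
Proof.
rewrite -(fintype.card_image (@mulgI 'S_n r^-1%g)) /=; apply: eq_card => s.
rewrite inE; apply/fintype.imageP/eqP => [[q]|sx].
  rewrite inE => /eqP qr ->; apply: eq_from_tnth => i.
  have := congr1 (fun t => tnth t ((r^-1)%g i)) qr.
  by rewrite !tnth_mktuple permM permKV.
exists (r * s)%g; last by rewrite mulgA mulVg mul1g.
rewrite inE; apply/eqP/eq_from_tnth => i; rewrite !tnth_mktuple permM.
by have := congr1 (fun t => tnth t (r i)) sx; rewrite !tnth_mktuple.
Qed.

Lemma perm_permv x (s : 'S_n) : perm_eq (permv s x) x.
Proof.
rewrite perm_sym; apply/tuple_permP; exists (s^-1)%g.
by congr val; apply: eq_from_tnth => i; rewrite !tnth_mktuple permKV.
Qed.

Lemma perm_eq_permvP x t : reflect (exists s, t = permv s x) (perm_eq t x).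
Proof.
apply: (iffP idP) => [/tuple_permP[s ts]|[s ->]]; last exact: perm_permv.
by exists s; exact: val_inj.
Qed.

(** Orbit-stabilizer: the permutations that give the same rearrangement form a
    coset of the stabilizer. *)
Lemma card_stabilizer x :
  (#|[pred s : 'S_n | permv s x == x]| * size (permutations x) = n`!)%N.
Proof.
rewrite -card_Sn -[RHS]sum1_card.
rewrite [RHS](eq_bigr (fun s : 'S_n =>
    \sum_(t <- permutations x) (permv s x == t :> seq T) : nat)%N); last first.
  move=> s _; rewrite (bigD1_seq (permv s x : seq T)) ?permutations_uniq//=.
    rewrite eqxx big1_seq // => t /andP[tx _].
    by rewrite eq_sym (negPf tx).
  by rewrite mem_permutations perm_permv.
rewrite [RHS]exchange_big /= [RHS](eq_big_seq (fun=> #|[pred s : 'S_n | permv s x == x]|)).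
  by rewrite big_const_seq count_predT iter_addn_0.
move=> t; rewrite mem_permutations => tx.
have st : size t == n by rewrite (perm_size tx) size_tuple.
have /perm_eq_permvP[r rE] : perm_eq (Tuple st) x by [].
rewrite -[RHS](card_permv_eq x r) -rE -sum1_card [RHS]big_mkcond /=.
apply: eq_bigr => s _; rewrite inE -val_eqE /=.
by case: eqP.
Qed.

End Stabilizer.

(** * Lambda n as a fundamental domain *)
Section Alcove.
Variable d : nat.
Implicit Types (k j h : d.+1.-tuple int).

(** With [N = d.+1 * n], points of [latticeH] have the same residues if and only
    if they differ by [N] times an integer vector of sum zero.  Hence [perm_eq]
    of the residues is equivalence under the affine Weyl group dilated by [N]. *)
Definition residues (N : nat) k : d.+1.-tuple int :=
  [tuple (tnth k i %% N%:Z)%Z | i < d.+1].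

Lemma tnth_residues N k i : tnth (residues N k) i = (tnth k i %% N%:Z)%Z.
Proof. exact: tnth_mktuple. Qed.

Lemma residues_permv N (s : 'S_d.+1) k :
  residues N (permv s k) = permv s (residues N k).
Proof. by apply: eq_from_tnth => i; rewrite !tnth_mktuple. Qed.

Lemma latticeH_permv (s : 'S_d.+1) k : latticeH k -> latticeH (permv s k).
Proof.
move=> [k0 kmod]; split; last by move=> i j; rewrite !tnth_mktuple.
rewrite -[RHS]k0 -[RHS](sum_reindex_perm s).
by apply: eq_bigr => i _; rewrite tnth_mktuple.
Qed.

Variable n : nat.
Hypothesis n0 : (0 < n)%N.
Let N := (d.+1 * n)%N.

Let N0 : (0 < N)%N. Proof. by rewrite muln_gt0. Qed.

Lemma Lambda_le k (i j : 'I_d.+1) : Lambda n k -> (i <= j)%N ->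
  tnth k j <= tnth k i.
Proof. by move=> [_ /sorted_tnthP + _]; apply. Qed.

Lemma Lambda_width k (i j : 'I_d.+1) : Lambda n k ->
  tnth k i <= tnth k j + N%:Z.
Proof.
move=> kL; have [_ _ kN] := kL.
apply: (le_trans (Lambda_le (i := ord0) kL _)) => //.
by apply: (le_trans kN); rewrite lerD2r (Lambda_le kL)// -ltnS.
Qed.

(** The entries of [k] lie within a window of length [N].  If the threshold [w]
    cuts this window, every quotient [(k_i - w) %/ N] is [0] or [-1] according to
    whether [w <= k_i]; otherwise all quotients are on the same side and the
    truncation gives the right answer. *)
Lemma Lambda_count_ge k (w : int) : Lambda n k ->
  \sum_(i < d.+1) ((w <= tnth k i)%R : nat)%:Z =
  Num.max 0 (Num.min (d.+1)%:Z
    ((d.+1)%:Z + \sum_(i < d.+1) ((tnth k i - w) %/ N%:Z)%Z)).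
Proof.
move=> kL.
have fl i : exists r, [/\ tnth k i - w = ((tnth k i - w) %/ N%:Z)%Z * N%:Z + r,
    0 <= r & r < N%:Z].
  exists ((tnth k i - w) %% N%:Z)%Z; split; first exact: divz_eq.
    by apply: modz_ge0; rewrite eqz_nat -lt0n.
  exact: ltz_pmod.
have sumc (c : int) : \sum_(i < d.+1) c = c * d.+1%:Z.
  by rewrite sumr_const card_ord -mulr_natr natz.
have [/existsP[a ka]|] := boolP [exists i, w <= tnth k i]; last first.
  rewrite negb_exists => /forallP kw.
  rewrite big1 => [|i _]; last by rewrite (negPf (kw i)).
  have : \sum_(i < d.+1) ((tnth k i - w) %/ N%:Z)%Z <= \sum_(i < d.+1) (-1).
    apply: ler_sum => i _; have := kw i; rewrite -ltNge; have [r []] := fl i.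
    move: (tnth k i) (_ %/ _)%Z => x q; move: N0; clearbody N; nia.
  by rewrite sumc; move: (\sum_(i < _) _) => S; lia.
have [/existsP[b kb]|] := boolP [exists i, tnth k i < w]; last first.
  rewrite negb_exists => /forallP kw.
  have {}kw i : w <= tnth k i by rewrite leNgt kw.
  rewrite (eq_bigr (fun=> 1)) => [|i _]; last by rewrite kw.
  have : \sum_(i < d.+1) 0 <= \sum_(i < d.+1) ((tnth k i - w) %/ N%:Z)%Z.
    apply: ler_sum => i _; have := kw i; have [r []] := fl i.
    move: (tnth k i) (_ %/ _)%Z => x q; move: N0; clearbody N; nia.
  by rewrite !sumc; move: (\sum_(i < _) _) => S; lia.
have E i : ((tnth k i - w) %/ N%:Z)%Z = ((w <= tnth k i)%R : nat)%:Z - 1.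
  have := Lambda_width i b kL; have := Lambda_width a i kL; have [r []] := fl i.
  move: ka kb; move: (tnth k i) (tnth k a) (tnth k b) (_ %/ _)%Z => x y z q.
  move: N0; clearbody N => N0'; case: (leP w x) => wx /=; nia.
rewrite [in RHS](eq_bigr _ (fun i _ => E i)) sumrB sumc.
have : 0 <= \sum_(i < d.+1) ((w <= tnth k i)%R : nat)%:Z <= \sum_(i < d.+1) 1.
  by rewrite sumr_ge0//= ler_sum// => i _; case: (w <= _).
by rewrite sumc; move: (\sum_(i < _) _) => S; lia.
Qed.

(** Adding [N a_i] to the entries shifts the quotients by [a_i], and these
    integers sum to zero. *)
Lemma sum_floor_residues k h (w : int) : latticeH k -> latticeH h ->
  perm_eq (residues N k) (residues N h) ->
  \sum_(i < d.+1) ((tnth k i - w) %/ N%:Z)%Z =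
  \sum_(i < d.+1) ((tnth h i - w) %/ N%:Z)%Z.
Proof.
move=> [k0 _] [h0 _] /perm_eq_permvP[s]; rewrite -residues_permv => kh.
have NZ : N%:Z != 0 by rewrite eqz_nat -lt0n.
have E i : exists a, tnth k i = a * N%:Z + tnth h (s i).
  have := congr1 (fun t => tnth t i) kh; rewrite !tnth_mktuple => /eqP.
  by rewrite eqz_mod_dvd => /dvdzP[a ka]; exists a; rewrite -ka subrK.
pose a i := ((tnth k i - tnth h (s i)) %/ N%:Z)%Z.
have {}E i : tnth k i = a i * N%:Z + tnth h (s i).
  by have [b kb] := E i; rewrite /a kb addrK mulzK.
have a0 : \sum_(i < d.+1) a i = 0.
  have : \sum_(i < d.+1) a i * N%:Z = 0.
    move: k0; rewrite (eq_bigr _ (fun i _ => E i)) big_split /=.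
    by rewrite (sum_reindex_perm s (tnth h)) h0 addr0.
  by rewrite -mulr_suml => /eqP; rewrite mulf_eq0 (negPf NZ) orbF => /eqP.
rewrite (eq_bigr (fun i => a i + ((tnth h (s i) - w) %/ N%:Z)%Z)).
  rewrite big_split /= a0 add0r.
  exact: (sum_reindex_perm s (fun i => ((tnth h i - w) %/ N%:Z)%Z)).
by move=> i _; rewrite E -addrA divzMDl.
Qed.

(** By the two previous lemmas the residues determine how many entries exceed any
    given threshold, hence the sorted sequence of the entries. *)
Lemma Lambda_residues_inj k j : Lambda n k -> Lambda n j ->
  perm_eq (residues N k) (residues N j) -> k = j.
Proof.
move=> kL jL kj; have [kH ksort _] := kL; have [jH jsort _] := jL.
have E w : \sum_(i < d.+1) ((w <= tnth k i)%R : nat)%:Z =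
    \sum_(i < d.+1) ((w <= tnth j i)%R : nat)%:Z.
  by rewrite !Lambda_count_ge// (sum_floor_residues w kH jH kj).
apply: val_inj; apply: (sorted_eq (leT := >=%R : rel int)) => //.
- by move=> a b c ba cb; exact: le_trans ba.
- by move=> a b /andP[ba ab]; apply: le_anti; apply/andP; split.
have cE (h : d.+1.-tuple int) v : (count_mem v h)%:Z =
    \sum_(i < d.+1) ((v <= tnth h i)%R : nat)%:Z -
    \sum_(i < d.+1) ((v + 1 <= tnth h i)%R : nat)%:Z.
  rewrite -sum1_count big_mkcond big_tuple /= -natz natr_sum -sumrB.
  apply: eq_bigr => i _; rewrite natz.
  by move: (tnth h i) => x; case: eqVneq; case: (leP v); case: (leP (v + 1)); lia.
apply/allP => v _ /=; apply/eqP/eqP; rewrite -eqz_nat; apply/eqP.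
by rewrite !cE !E.
Qed.

Lemma residues_val k :
  residues N k = [seq (x %% N%:Z)%Z | x <- k] :> seq int.
Proof. by rewrite -[in RHS](map_tnth_enum k) -map_comp. Qed.

(** Reduce the entries to the interval from [0] to [N] and sort them decreasingly.
    Their sum is [A N] with [A <= d]; subtracting [N] from the [A] largest ones
    and moving these to the end gives sum zero and keeps the order and the
    width. *)
Lemma Lambda_residues_surj h : latticeH h ->
  exists2 j, Lambda n j & perm_eq (residues N h) (residues N j).
Proof.
move=> [h0 hmod]; have NZ : N%:Z != 0 by rewrite eqz_nat -lt0n.
pose r := sort (>=%R : rel int) (residues N h).
have rperm : perm_eq r (residues N h) by exact/permPl/perm_sort.
have sr : size r = d.+1 by rewrite size_sort size_tuple.
have rP x : x \in r -> [/\ 0 <= x, x < N%:Z & (x = tnth h ord0 %[mod d.+1])%Z].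
  rewrite (perm_mem rperm) => /tnthP[i ->]; rewrite tnth_mktuple; split.
  - exact: modz_ge0.
  - exact: ltz_pmod.
  - rewrite (hmod ord0 i); apply/eqP; rewrite eqz_mod_dvd.
    rewrite {2}(divz_eq (tnth h i) N%:Z) opprD addrCA subrr addr0 rpredN.
    by rewrite /N PoszM mulrCA dvdz_mulr.
have rsort : pairwise (>=%R : rel int) r.
  rewrite -sorted_pairwise; last by move=> a b c ba cb; exact: le_trans ba.
  by apply: sort_sorted => a b; exact: le_total.
have [A Asum] : exists A : nat, \sum_(x <- r) x = A%:Z * N%:Z.
  pose S := \sum_(x <- r) x.
  have S0 : 0 <= S by rewrite /S big_seq sumr_ge0// => x /rP[].
  have /dvdzP[q qE] : (N%:Z %| S)%Z.
    have -> : S = \sum_(i < d.+1) (tnth h i - (tnth h i %/ N%:Z)%Z * N%:Z).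
      rewrite /S (perm_big _ rperm) big_tuple; apply: eq_bigr => i _.
      by rewrite tnth_mktuple {2}(divz_eq (tnth h i) N%:Z) addrAC subrr add0r.
    by rewrite sumrB h0 sub0r rpredN -mulr_suml dvdz_mull.
  exists (absz q); rewrite -/S qE; congr (_ * _).
  by move: S0; rewrite qE; move: N0; clearbody N; nia.
have Ad : (A <= d)%N.
  have : \sum_(x <- r) x < \sum_(x <- r) N%:Z.
    rewrite big_seq [ltRHS]big_seq; apply: ltr_sum => [|x /rP[]//].
    by apply/hasP; exists (nth 0 r 0); rewrite mem_nth ?sr.
  rewrite Asum big_const_seq count_predT sr iter_addr_0.
  by rewrite -mulr_natr natz; move: N0; clearbody N; nia.
pose js := drop A r ++ [seq x - N%:Z | x <- take A r].
have sA : size (take A r) = A by rewrite size_takel// sr ltnW.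
have sjs : size js == d.+1.
  by rewrite size_cat size_map sA size_drop sr subnK// ltnW.
pose j := Tuple sjs.
have inr x : x \in drop A r -> x \in r by exact: mem_drop.
have int x : x \in take A r -> x \in r by exact: mem_take.
move: (rsort); rewrite -{1}(cat_take_drop A r) pairwise_cat => /and3P[/allrelP rtd rt rd].
have jP x : x \in js ->
    [/\ -N%:Z <= x, x < N%:Z & (x = tnth h ord0 %[mod d.+1])%Z].
  rewrite mem_cat => /orP[/inr/rP[x0 xN xm]|/mapP[y /int/rP[y0 yN ym] ->]].
    by split => //; apply: le_trans x0; rewrite oppr_le0.
  split; [by rewrite lerBrDr addNr|by rewrite ltrBlDr (lt_le_trans yN)// lerDl|].
  rewrite -ym; apply/eqP; rewrite eqz_mod_dvd addrAC subrr sub0r rpredN.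
  by rewrite /N PoszM dvdz_mulr.
have jw x y : x \in js -> y \in js -> x <= y + N%:Z.
  rewrite !mem_cat => /orP[xd|/mapP[x' /int/rP[x0 xN _] ->]].
    move=> /orP[/inr/rP[y0 _ _]|/mapP[y' yt ->]].
      by have [_ /ltW xN _] := rP _ (inr _ xd); rewrite (le_trans xN)// lerDr.
    by rewrite subrK; exact: rtd.
  move=> /orP[/inr/rP[y0 _ _]|/mapP[y' /int/rP[y0 _ _] ->]].
    by move: xN x0 y0; lia.
  by move: xN x0 y0; lia.
exists j.
  split.
  - split; last first.
      move=> a b; have [_ _ ->] := jP _ (mem_tnth a j).
      by have [_ _ ->] := jP _ (mem_tnth b j).
    rewrite -(big_tuple _ _ j xpredT id) /= /js big_cat big_map /=.
    rewrite sumrB big_const_seq count_predT sA iter_addr_0 addrA -big_cat /=.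
    rewrite (perm_big r) /=; last first.
      by rewrite perm_catC cat_take_drop.
    by rewrite Asum -mulr_natr natz mulrC subrr.
  - rewrite sorted_pairwise; last by move=> a b c ba cb; exact: le_trans ba.
    rewrite /= pairwise_cat rd pairwise_map; apply/and3P; split => //.
      apply/allrelP => x y /inr/rP[x0 _ _] /mapP[z /int/rP[_ zN _] ->].
      by rewrite /= (le_trans _ x0)// subr_le0 ltW.
    by apply: sub_pairwise rt => x y /=; rewrite lerD2r.
  - by apply: jw; exact: mem_tnth.
rewrite perm_sym residues_val /= map_cat -map_comp.
have mE s : {subset s <= r} -> [seq (x %% N%:Z)%Z | x <- s] = s.
  move=> sr'; rewrite -[RHS]map_id; apply/eq_in_map => x /sr'/rP[x0 xN _].
  by rewrite modz_small// x0 xN.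
rewrite mE// (_ : [seq _ | x <- take A r] = take A r); last first.
  rewrite -[RHS](mE (take A r))//; apply: eq_map => x /=.
  by rewrite -[RHS](modzMDl (-1)) mulN1r addrC.
by rewrite perm_catC cat_take_drop.
Qed.

(** The weight of [k] is the size of its orbit modulo [N].  When the largest and
    the smallest entry differ by exactly [N] their residues coincide, which is
    why their multiplicities are added in the second case of [lambda]. *)
Lemma lambda_permutations (R : realType) k : Lambda n k ->
  lambda R n k = (size (permutations (residues N k)))%:R.
Proof.
move=> kL; have [_ _ kN] := kL.
have prodE : (\prod_(v <- undup (residues N k)) (count_mem v (residues N k))`!)%N%:R != 0 :> R.
  by rewrite pnatr_eq0 -lt0n; apply: prodn_gt0 => v; exact: fact_gt0.
have -> : (size (permutations (residues N k)))%:R = d.+1`!%:R /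
    (\prod_(v <- undup (residues N k)) (count_mem v (residues N k))`!)%N%:R :> R.
  have := multinomial_permutations (residues N k); rewrite size_tuple => <-.
  by rewrite natrM mulfK.
have km x : x \in (k : seq int) -> tnth k ord_max <= x <= tnth k ord0.
  by move=> /tnthP[i ->]; rewrite !(Lambda_le kL)//= -ltnS.
have modinj (a : int) (s : seq int) : (forall x, x \in s -> a <= x < a + N%:Z) ->
    {in s &, injective (fun x => (x %% N%:Z)%Z)}.
  move=> sa x y /sa/andP[x1 x2] /sa/andP[y1 y2] /eqP.
  rewrite eqz_mod_dvd => /dvdzP[q qE].
  have [q1|q1|q0] := ltrgtP q 0; last by move: qE; rewrite q0 mul0r; lia.
    by have : q * N%:Z <= -1 * N%:Z; [rewrite ler_pM2r; lia|lia].
  by have : 1 * N%:Z <= q * N%:Z; [rewrite ler_pM2r; lia|lia].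
rewrite /lambda; case: ifPn => [kN'|].
  rewrite residues_val prod_count_fact_map ?natr_prod//.
  apply: (modinj (tnth k ord_max)) => x /km /andP[-> /=] /le_lt_trans; apply.
  exact: kN'.
rewrite -leNgt -/N => kN'.
have {kN'}kE : tnth k ord0 = tnth k ord_max + N%:Z.
  by apply/eqP; rewrite eq_le kN'; move: kN; rewrite -/N => ->.
move: kE km; set kmax := tnth k ord0; set kmin := tnth k ord_max => kE km.
(* Replacing [kmax] by [kmin] keeps the residues and makes reduction modulo
   [N] injective on the entries. *)
pose g v := if v == kmax then kmin else v.
have kne : kmax != kmin.
  by rewrite kE; apply/eqP => /esym/eqP; rewrite -subr_eq0; move: N0; clearbody N; lia.
have gE : residues N k = [seq (x %% N%:Z)%Z | x <- map g k] :> seq int.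
  rewrite residues_val -map_comp; apply: eq_map => x /=; rewrite /g.
  by case: eqP => // ->; rewrite kE modzDr.
rewrite gE prod_count_fact_map; last first.
  apply: (modinj kmin) => x /mapP[y /km ky ->]; rewrite /g -kE.
  by move: ky kE; case: eqVneq => [_|yk]; move: N0; clearbody N kmin kmax; lia.
have kmin_in : kmin \in undup (map g k).
  rewrite mem_undup; apply/mapP; exists kmin; first exact: mem_tnth.
  by rewrite /g; case: ifP.
have cmin : (count_mem kmin (map g k) = count_mem kmax k + count_mem kmin k)%N.
  rewrite count_map -count_predUI [X in (_ + X)%N](eq_count (a2 := pred0)).
    rewrite count_pred0 addn0; apply: eq_count => x /=; rewrite /g.
    by case: (eqVneq x kmax) => [_|//]; rewrite eqxx.
  by move=> x /=; case: eqP => //= ->; rewrite (negPf kne).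
rewrite (bigD1_seq kmin) ?undup_uniq//= natrM cmin natr_prod.
congr (_ / (_ * _)); rewrite -big_filter -[RHS]big_filter.
rewrite [RHS](perm_big [seq v <- undup k | (v != kmax) && (v != kmin)]) /=.
  apply: eq_big_seq => v; rewrite mem_filter => /andP[/andP[v1 v2] _].
  rewrite count_map; congr (_`!%:R); apply: eq_count => x /=; rewrite /g.
  case: (eqVneq x kmax) => [->|//].
  by rewrite ![_ == v]eq_sym (negPf v1) (negPf v2).
apply: uniq_perm; rewrite ?filter_uniq ?undup_uniq// => v.
rewrite !mem_filter !mem_undup; apply/andP/andP => [[v2 /mapP[x xk]]|[/andP[v1 v2] vk]].
  rewrite /g; case: eqP => [_ vE|/eqP xmax vE]; first by rewrite vE eqxx in v2.
  by rewrite -vE in xk xmax; rewrite xmax v2.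
by split => //; apply/mapP; exists v => //; rewrite /g (negPf v1).
Qed.

End Alcove.

(** * The finite quotient of the lattice *)
Lemma eq_of_small_multiple (m a b : nat) (q : int) : (a < m)%N -> (b < m)%N ->
  a%:Z - b%:Z = q * m%:Z -> a = b.
Proof.
move=> am bm qE; have [q1|q1|q0] := ltrgtP q 0; last by move: qE; rewrite q0 mul0r; lia.
  by have : q * m%:Z <= -1 * m%:Z; [rewrite ler_pM2r; lia|lia].
by have : 1 * m%:Z <= q * m%:Z; [rewrite ler_pM2r; lia|lia].
Qed.

Lemma Lambda_enum d n : exists L : seq (d.+1.-tuple int),
  [/\ uniq L, forall k, k \in L <-> Lambda n k &
      forall (R : realType) (F : d.+1.-tuple int -> R[i]),
        \sum_(k \in Lambda n) F k = \sum_(k <- L) F k].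
Proof.
exists (finmap.enum_fset (fset_set (@Lambda d n))); split.
- exact: finmap.fset_uniq.
- move=> k; split => [kL|kL].
    by apply/set_mem; rewrite -in_fset_set//; exact: finite_Lambda.
  by have := mem_set kL; rewrite -in_fset_set//; exact: finite_Lambda.
- by move=> R F; rewrite fsbig_finite//; exact: finite_Lambda.
Qed.

Section Torus.
Variables d n : nat.
Hypotheses (d0 : (0 < d)%N) (n0 : (0 < n)%N).
Let N := (d.+1 * n)%N.
Let w := widen_ord (leqnSn d).
Implicit Types (k j h : d.+1.-tuple int).
Local Notation cell := ('I_d.+1 * {ffun 'I_d -> 'I_n})%type.
Implicit Type y : cell.

(** The [d.+1 * n ^ d] points [cell_point y] represent [latticeH] modulo [N] times
    the integer vectors of sum zero: the first [d] entries have a common residue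
    [y.1] modulo [d.+1] and are free modulo [N] otherwise, and the last entry is
    determined by them. *)
Definition cell_coord y (i : 'I_d) : int :=
  (y.1 : nat)%:Z + d.+1%:Z * (y.2 i : nat)%:Z.

Definition cell_point y : d.+1.-tuple int :=
  [tuple if unlift ord_max i is Some i' then cell_coord y i'
         else - \sum_(i' < d) cell_coord y i' | i < d.+1].

Lemma tnth_cell_widen y i : tnth (cell_point y) (w i) = cell_coord y i.
Proof.
have wl : w i = lift ord_max i by apply: val_inj; exact: (esym (lift_max i)).
by rewrite tnth_mktuple wl liftK.
Qed.

Lemma tnth_cell_max y :
  tnth (cell_point y) ord_max = - \sum_(i < d) cell_coord y i.
Proof. by rewrite tnth_mktuple unlift_none. Qed.

Lemma cell_point_latticeH y : latticeH (cell_point y).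
Proof.
split.
  rewrite big_ord_recr /= tnth_cell_max.
  by apply/eqP; rewrite subr_eq0; apply/eqP/eq_bigr => i _; rewrite tnth_cell_widen.
have E i : (tnth (cell_point y) i = y.1%:Z %[mod d.+1])%Z.
  apply/eqP; rewrite eqz_mod_dvd; case: (ord_maxP i) => [->|[i' ->]].
    rewrite tnth_cell_max /cell_coord big_split /= sumr_const card_ord -mulr_sumr.
    apply/dvdzP; exists (- y.1%:Z - \sum_(i < d) (y.2 i)%:Z).
    have -> : d.+1%:Z = d%:Z + 1 by lia.
    by rewrite -mulr_natr natz; ring.
  by rewrite tnth_cell_widen /cell_coord addrAC subrr add0r dvdz_mulr.
by move=> i j; rewrite E.
Qed.

Lemma cell_point_inj : injective (fun y => residues N (cell_point y)).
Proof.
move=> y y' yy'.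
have E i : (cell_coord y i = cell_coord y' i %[mod N])%Z.
  by have := congr1 (fun t => tnth t (w i)) yy'; rewrite !tnth_residues !tnth_cell_widen.
have y1 : y.1 = y'.1.
  have /eqP := E (Ordinal d0); rewrite eqz_mod_dvd /cell_coord => /dvdzP[q qE].
  apply/val_inj => /=; apply: (@eq_of_small_multiple d.+1 _ _
    (q * n%:Z + (y'.2 (Ordinal d0) : nat)%:Z - (y.2 (Ordinal d0) : nat)%:Z)) => //.
  move: qE; rewrite /N PoszM; set a := (y.1 : nat)%:Z; set b := (y'.1 : nat)%:Z.
  set u := (y.2 _ : nat)%:Z; set v := (y'.2 _ : nat)%:Z => qE.
  have -> : a - b = a + d.+1%:Z * u - (b + d.+1%:Z * v) + d.+1%:Z * v - d.+1%:Z * u.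
    by ring.
  by rewrite qE; ring.
have y2 i : y.2 i = y'.2 i.
  have /eqP := E i; rewrite eqz_mod_dvd /cell_coord y1.
  rewrite opprD addrACA subrr add0r -mulrBr /N PoszM dvdz_mul2l// => /dvdzP[q qE].
  apply/val_inj => /=; exact: (@eq_of_small_multiple n _ _ q).
case: y y' y1 y2 {yy' E} => [c f] [c' f'] /= -> ff'; congr pair.
by apply/ffunP.
Qed.

Lemma cell_point_surj h : latticeH h ->
  exists y, residues N (cell_point y) = residues N h.
Proof.
move=> [h0 hmod].
have nZ : n%:Z != 0 by rewrite eqz_nat -lt0n.
pose c := absz (tnth h ord_max %% d.+1)%Z.
have cE : c%:Z = (tnth h ord_max %% d.+1)%Z by rewrite gez0_abs ?modz_ge0.
have cd : (c < d.+1)%N by rewrite -ltz_nat cE ltz_pmod.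
pose q i := (tnth h (w i) %/ d.+1)%Z.
have hE i : tnth h (w i) = c%:Z + d.+1%:Z * q i.
  by rewrite {1}(divz_eq (tnth h (w i)) d.+1) addrC mulrC cE (hmod (w i) ord_max).
pose b i := absz (q i %% n)%Z.
have bE i : (b i)%:Z = (q i %% n)%Z by rewrite gez0_abs ?modz_ge0.
have bn i : (b i < n)%N by rewrite -ltz_nat bE ltz_pmod.
pose y : cell := (Ordinal cd, [ffun i => Ordinal (bn i)]).
have yh i : (N%:Z %| cell_coord y i - tnth h (w i))%Z.
  rewrite /cell_coord /= ffunE /= hE bE opprD addrACA subrr add0r -mulrBr.
  rewrite /N PoszM dvdz_mul2l// {2}(divz_eq (q i) n%:Z) opprD addrCA subrr addr0.
  by rewrite rpredN dvdz_mull.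
exists y; apply: eq_from_tnth => i; rewrite !tnth_residues.
apply/eqP; rewrite eqz_mod_dvd; case: (ord_maxP i) => [->|[i' ->]]; last first.
  by rewrite tnth_cell_widen.
move: h0; rewrite big_ord_recr /= => /eqP; rewrite addrC addr_eq0 => /eqP ->.
rewrite tnth_cell_max opprK addrC -sumrB rpred_sum// => i' _.
by rewrite -rpredN opprB.
Qed.

(** Reduction modulo [N] is a bijection from the cells in the orbit of [j] to the
    rearrangements of the residues of [j]. *)
Lemma card_cell_residues j : latticeH j ->
  #|[pred y | perm_eq (residues N (cell_point y)) (residues N j)]| =
  size (permutations (residues N j)).
Proof.
move=> jH; pose F y := residues N (cell_point y) : seq int.
have Finj : injective F by move=> y y' /val_inj/cell_point_inj.
rewrite cardE -(size_map F); apply: perm_size; apply: uniq_perm.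
- by rewrite map_inj_uniq ?enum_uniq.
- exact: permutations_uniq.
move=> t; rewrite mem_permutations; apply/mapP/idP => [[y]|tj].
  by rewrite mem_enum inE => yj ->.
have st : size t == d.+1 by rewrite (perm_size tj) size_tuple.
have /perm_eq_permvP[s] : perm_eq (Tuple st) (residues N j) by [].
rewrite -residues_permv => /(congr1 val) /= tE.
have [y yE] := cell_point_surj (latticeH_permv s jH).
exists y; last by rewrite /F yE.
rewrite mem_enum; have : perm_eq (residues N (cell_point y)) (residues N j).
  by rewrite yE /= -tE.
by [].
Qed.

(** An invariant function is summed orbit by orbit: every cell lies in the orbit
    of a single point of [Lambda n], and [lambda] is the size of the orbit. *)
Lemma sum_cell_Lambda (R : realType) (f : d.+1.-tuple int -> R[i]) :
  (forall h j, latticeH h -> latticeH j ->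
     perm_eq (residues N h) (residues N j) -> f h = f j) ->
  \sum_y f (cell_point y) = \sum_(j \in Lambda n) (lambda R n j)%:C%C * f j.
Proof.
move=> finv; have [L [uL LP ->]] := Lambda_enum d n.
transitivity (\sum_y \sum_(j <- L)
    (perm_eq (residues N (cell_point y)) (residues N j))%:R * f j).
  apply: eq_bigr => y _; have yH := cell_point_latticeH y.
  have [j jL yj] := Lambda_residues_surj n0 yH.
  have jin : j \in L by exact/LP.
  rewrite (bigD1_seq j)//= yj mul1r (finv _ j)//; last by case: jL.
  rewrite big1_seq ?addr0// => i /andP[ij /LP iL].
  case: (boolP (perm_eq _ _)) => [yi|]; last by rewrite mul0r.
  case/eqP: ij; apply: (Lambda_residues_inj n0 iL jL).
  by rewrite -(permPl yi).
rewrite exchange_big /=; apply: eq_big_seq => j /LP jL.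
rewrite -mulr_suml; congr (_ * _); rewrite lambda_permutations//.
rewrite -(card_cell_residues (j := j)); last by case: jL.
rewrite rmorph_nat -sum1_card natr_sum [RHS]big_mkcond /=.
by apply: eq_bigr => y _; rewrite unfold_in /=; case: perm_eq.
Qed.

End Torus.

(** * Characters of the finite quotient *)
Section Characters.
Variables (R : realType) (d n : nat).
Hypotheses (d0 : (0 < d)%N) (n0 : (0 < n)%N).
Let N := (d.+1 * n)%N.
Let w := widen_ord (leqnSn d).
Implicit Types (k j h : d.+1.-tuple int).
Local Notation cell := ('I_d.+1 * {ffun 'I_d -> 'I_n})%type.

Let N0 : (0 < N)%N. Proof. by rewrite muln_gt0. Qed.

Lemma eq_expi_frac (M : nat) (a b : int) : (0 < M)%N -> (M%:Z %| a - b)%Z ->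
  expi (2 * pi * (a%:~R / M%:R)) = expi (2 * pi * (b%:~R / M%:R)) :> R[i].
Proof.
move=> M0 /dvdzP[q qE]; have MR : (M%:R : R) != 0 by rewrite pnatr_eq0 -lt0n.
have -> : a%:~R / M%:R = b%:~R / M%:R + q%:~R :> R.
  by rewrite -(subrK b a) qE intrD intrM -[M%:Z%:~R]/(M%:R) mulrDl mulfK// addrC.
by rewrite mulrDr expiD expi2piz mulr1.
Qed.

(** A geometric sum of an [M]-th root of unity. *)
Lemma sum_expi_frac (M : nat) (a : int) : (0 < M)%N ->
  \sum_(y < M) expi (2 * pi * ((a * (y : nat)%:Z)%:~R / M%:R)) =
  M%:R * (M%:Z %| a)%Z%:R :> R[i].
Proof.
move=> M0; pose z : R[i] := expi (2 * pi * (a%:~R / M%:R)).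
have MR : (M%:R : R) != 0 by rewrite pnatr_eq0 -lt0n.
rewrite (eq_bigr (fun y : 'I_M => z ^+ y)); last first.
  move=> y _; rewrite /z -expiMn; congr expi.
  by rewrite intrM -[(y : nat)%:Z%:~R]/((y : nat)%:R) -mulr_natr; field.
have zM : z ^+ M = 1.
  rewrite /z -expiMn -(expi2piz R a); congr expi.
  by rewrite -mulr_natr; field.
rewrite -(expi_frac_eq1 R)// -/z; have [->|z1] := eqVneq z 1.
  by rewrite (eq_bigr (fun=> 1)) => [|y _]; rewrite ?expr1n// sumr_const card_ord mulr1.
rewrite mulr0; apply: (@mulfI _ (z - 1)); first by rewrite subr_eq0.
by rewrite -subrX1 zM subrr mulr0.
Qed.

Definition dot k h : int := \sum_(i < d.+1) tnth k i * tnth h i.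

(** The value of [phi k] at the node of [h]. *)
Definition chi k h : R[i] := expi (2 * pi * ((dot k h)%:~R / (d.+1 * N)%:R)).

Lemma phi_node k h (s : 'S_d.+1) :
  phi k (permt (node R n h) s) = chi k (permv s h).
Proof.
rewrite /phi /chi; congr expi.
rewrite /dot rmorph_sum /= mulr_suml !mulr_sumr; apply: eq_bigr => i _.
rewrite !tnth_mktuple intrM -/N natrM.
have dR : (d.+1%:R : R) != 0 by rewrite pnatr_eq0.
have NR : (N%:R : R) != 0 by rewrite pnatr_eq0 -lt0n.
move: dR NR; move: (pi : R) (d.+1%:R : R) (N%:R : R) => p x y x0 y0.
by field; rewrite x0 y0.
Qed.

(** The differences of the entries of [h] and [j] are [N a_i] with sum zero, so
    [k] may be replaced by [k - k_0], whose entries are multiples of [d.+1]. *)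
Lemma chi_residues k h j : latticeH k -> latticeH h -> latticeH j ->
  residues N h = residues N j -> chi k h = chi k j.
Proof.
move=> [_ kmod] [h0 _] [j0 _] hj; apply: eq_expi_frac; first by rewrite muln_gt0.
have -> : dot k h - dot k j =
    \sum_(i < d.+1) (tnth k i - tnth k ord0) * (tnth h i - tnth j i).
  rewrite (eq_bigr _ (fun i _ => mulrBl _ _ _)) sumrB -mulr_sumr sumrB h0 j0.
  by rewrite subrr mulr0 subr0 /dot -sumrB; apply: eq_bigr => i _; rewrite mulrBr.
apply: rpred_sum => i _; rewrite PoszM; apply: dvdz_mul.
  by rewrite -eqz_mod_dvd; apply/eqP; exact: kmod.
have := congr1 (fun t => tnth t i) hj; rewrite !tnth_residues => /eqP.
by rewrite eqz_mod_dvd.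
Qed.

Lemma dot_permv k h (s : 'S_d.+1) : dot k (permv s h) = dot (permv (s^-1)%g k) h.
Proof.
rewrite /dot -[LHS](sum_reindex_perm (s^-1)%g).
by apply: eq_bigr => i _; rewrite !tnth_mktuple permKV.
Qed.

Lemma chi_permv k h (s : 'S_d.+1) : chi k (permv s h) = chi (permv (s^-1)%g k) h.
Proof. by rewrite /chi dot_permv. Qed.

Lemma permvM (T : Type) m (s r : 'S_m) (x : m.-tuple T) :
  permv s (permv r x) = permv (s * r)%g x.
Proof. by apply: eq_from_tnth => i; rewrite !tnth_mktuple permM. Qed.

Lemma TC_node k h :
  TC k (node R n h) = (d.+1`!%:R)^-1 * \sum_(s : 'S_d.+1) chi k (permv s h).
Proof. by congr (_ * _); apply: eq_bigr => s _; exact: phi_node. Qed.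

Lemma TC_node_residues k h j : latticeH k -> latticeH h -> latticeH j ->
  perm_eq (residues N h) (residues N j) ->
  TC k (node R n h) = TC k (node R n j) :> R[i].
Proof.
move=> kH hH jH /perm_eq_permvP[r hr]; rewrite !TC_node; congr (_ * _).
rewrite [RHS](reindex_inj (@mulIg 'S_d.+1 r)) /=; apply: eq_bigr => s _.
rewrite -permvM; apply: chi_residues => //; try exact: latticeH_permv.
  by apply: latticeH_permv; exact: latticeH_permv.
by rewrite !residues_permv hr.
Qed.

(** The entries of [k] are [k_last + m_i (d+1)], so that the character splits into
    a product over the parameters of the cell. *)
Lemma chi_cell k (y : cell) (m : 'I_d -> int) : latticeH k ->
  (forall i, tnth k (w i) - tnth k ord_max = m i * d.+1%:Z) ->
  \sum_(i < d) m i = - tnth k ord_max /\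
  chi k (cell_point y) =
  expi (2 * pi * ((- tnth k ord_max * (y.1 : nat)%:Z)%:~R / N%:R)) *
  \prod_(i < d) expi (2 * pi * ((m i * (y.2 i : nat)%:Z)%:~R / n%:R)).
Proof.
move=> [k0 kmod] mE.
have msum : \sum_(i < d) m i = - tnth k ord_max.
  apply: (@mulIf _ d.+1%:Z) => //; rewrite mulr_suml.
  rewrite (eq_bigr _ (fun i _ => esym (mE i))) sumrB sumr_const card_ord.
  move: k0; rewrite big_ord_recr /= => /eqP; rewrite addr_eq0 => /eqP ->.
  rewrite -mulr_natr natz; have -> : d.+1%:Z = d%:Z + 1 by lia.
  by ring.
split => //; rewrite -expi_sum -expiD; congr expi.
rewrite -mulr_sumr -mulrDr; congr (_ * _).
have -> : dot k (cell_point y) = d.+1%:Z *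
    (- tnth k ord_max * (y.1 : nat)%:Z + d.+1%:Z * \sum_(i < d) m i * (y.2 i : nat)%:Z).
  rewrite /dot big_ord_recr /= tnth_cell_max mulrN mulr_sumr -sumrB.
  rewrite -msum mulrDr mulr_suml mulr_sumr !mulr_sumr -big_split /=.
  apply: eq_bigr => i _; rewrite tnth_cell_widen -mulrBl mE /cell_coord.
  by ring.
have dR : (d.+1%:R : R) != 0 by rewrite pnatr_eq0.
have nR : (n%:R : R) != 0 by rewrite pnatr_eq0 -lt0n.
rewrite intrM intrD [(d.+1%:Z * _)%:~R]intrM -[d.+1%:Z%:~R]/(d.+1%:R) /N !natrM.
rewrite -mulr_suml -rmorph_sum /=.
move: dR nR; move: (_%:~R) (_%:~R) (d.+1%:R : R) (n%:R : R) => a b x y' x0 y0.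
by field; rewrite x0 y0.
Qed.

(** By the product form the sum vanishes unless [n] divides all [m_i] and then
    [d.+1] divides [k_last / n]; together this says that [N] divides [k]. *)
Lemma sum_chi_cell k : latticeH k ->
  \sum_(y : cell) chi k (cell_point y) =
  (d.+1 * n ^ d)%:R * [forall i, (N%:Z %| tnth k i)%Z]%:R.
Proof.
move=> kH; have [k0 kmod] := kH.
pose m i := ((tnth k (w i) - tnth k ord_max) %/ d.+1)%Z.
have mE i : tnth k (w i) - tnth k ord_max = m i * d.+1%:Z.
  by apply/esym/divzK; rewrite -eqz_mod_dvd; apply/eqP; exact: kmod.
have cE y := chi_cell y kH mE.
have msum : \sum_(i < d) m i = - tnth k ord_max.
  have [//] := cE (ord0, [ffun=> Ordinal n0]).
rewrite (eq_bigr _ (fun y _ => (cE y).2)).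
pose F (c : 'I_d.+1) : R[i] := expi (2 * pi * ((- tnth k ord_max * (c : nat)%:Z)%:~R / N%:R)).
pose G (f : {ffun 'I_d -> 'I_n}) : R[i] :=
  \prod_(i < d) expi (2 * pi * ((m i * (f i : nat)%:Z)%:~R / n%:R)).
rewrite -(pair_bigA _ (fun c f => F c * G f)) /=.
rewrite -big_distrlr /= /G -(bigA_distr_bigA (fun i (j : 'I_n) =>
  expi (2 * pi * ((m i * (j : nat)%:Z)%:~R / n%:R)) : R[i])) /=.
rewrite (eq_bigr _ (fun i _ => sum_expi_frac (m i) n0)) big_split /=.
rewrite prodr_const card_ord.
have NE : N%:Z = d.+1%:Z * n%:Z by rewrite /N PoszM.
have [/existsP[i ni]|] := boolP [exists i, ~~ (n%:Z %| m i)%Z].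
  rewrite (bigD1 i)//= (negPf ni) mul0r !mulr0.
  case: (boolP [forall i, _]) => [/forallP kN|]; last by rewrite mulr0.
  have : (N%:Z %| m i * d.+1%:Z)%Z by rewrite -mE rpredB.
  by rewrite NE mulrC dvdz_mul2l// (negPf ni).
rewrite negb_exists => /forallP nm; have {}nm i : (n%:Z %| m i)%Z by have := nm i; rewrite negbK.
rewrite [X in _ * (_ * X)]big1 ?mulr1; last by move=> i _; rewrite nm.
have /dvdzP[B BE] : (n%:Z %| - tnth k ord_max)%Z by rewrite -msum rpred_sum.
have nR : (n%:R : R) != 0 by rewrite pnatr_eq0 -lt0n.
have -> : \sum_i F i = d.+1%:R * (d.+1%:Z %| B)%Z%:R.
  rewrite -sum_expi_frac//; apply: eq_bigr => c _; rewrite /F BE; congr (expi (_ * _)).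
  rewrite /N natrM !intrM -[n%:Z%:~R]/(n%:R).
  have dR : (d.+1%:R : R) != 0 by rewrite pnatr_eq0.
  move: dR nR; move: (d.+1%:R : R) (n%:R : R) => x z x0 z0.
  by field; rewrite x0 z0.
rewrite natrM natrX mulrAC; congr (_ * _%:R); congr nat_of_bool.
have kmaxE : (N%:Z %| tnth k ord_max)%Z = (d.+1%:Z %| B)%Z.
  by rewrite -rpredN BE NE dvdz_mul2r ?eqz_nat -?lt0n.
apply/idP/forallP => [dB i|kN]; last by rewrite -kmaxE.
case: (ord_maxP i) => [->|[i' ->]]; first by rewrite kmaxE.
rewrite -(subrK (tnth k ord_max) (tnth k _)) rpredD ?kmaxE//.
by rewrite mE NE mulrC dvdz_mul2l.
Qed.

End Characters.

(** * The cubature formula *)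
Section Cubature.
Variables (R : realType) (d n : nat).
Hypotheses (d0 : (0 < d)%N) (n0 : (0 < n)%N).
Let N := (d.+1 * n)%N.
Implicit Types (k j h : d.+1.-tuple int).
Local Notation cell := ('I_d.+1 * {ffun 'I_d -> 'I_n})%type.
Local Notation volume := ((d.+1 * n ^ d)%:R : R[i]).

Let N0 : (0 < N)%N. Proof. by rewrite muln_gt0. Qed.

Lemma volume_neq0 : volume != 0.
Proof. by rewrite pnatr_eq0 -lt0n muln_gt0 expn_gt0 n0. Qed.

Lemma fact_neq0 : (d.+1`!%:R : R[i]) != 0.
Proof. by rewrite pnatr_eq0 -lt0n fact_gt0. Qed.

Lemma eq_cubature (f g : d.+1.-tuple R -> R[i]) :
  (forall j, Lambda n j -> f (node R n j) = g (node R n j)) ->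
  cubature n f = cubature n g.
Proof.
move=> fg; rewrite /cubature; have [L [_ LP sumE]] := Lambda_enum d n.
rewrite !sumE; congr (_ * _); apply: eq_big_seq => j /LP jL.
by rewrite fg.
Qed.

Lemma cubature_cell (f : d.+1.-tuple R -> R[i]) :
  (forall h j, latticeH h -> latticeH j ->
     perm_eq (residues N h) (residues N j) -> f (node R n h) = f (node R n j)) ->
  cubature n f = volume^-1 * \sum_(y : cell) f (node R n (cell_point y)).
Proof.
by move=> finv; congr (_ * _); rewrite (sum_cell_Lambda d0 n0 finv).
Qed.

(** The width of [k] is at most [(d+1)(2n-1) < 2N], so the quotients [k_i / N]
    differ by at most one; as they sum to zero, they vanish.  This is where the
    degree [2n-1] comes from. *)
Lemma Lambda_dvd_eq0 k : Lambda (2 * n - 1) k ->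
  [forall i, (N%:Z %| tnth k i)%Z] = [forall i, tnth k i == 0].
Proof.
move=> kL; have [[k0 _] _ _] := kL.
apply/forallP/forallP => [kN i|k00 i]; last by rewrite (eqP (k00 i)) dvdz0.
pose a i := (tnth k i %/ N%:Z)%Z.
have aE i' : tnth k i' = a i' * N%:Z by apply/esym/divzK.
have asum : \sum_(i < d.+1) a i = 0.
  apply/eqP; rewrite -(mulIr_eq0 _ (@mulIf _ N%:Z _)) ?eqz_nat -?lt0n//.
  by rewrite mulr_suml -(eq_bigr _ (fun i _ => aE i)) k0.
have a1 p q : a p <= a q + 1.
  have := Lambda_width p q kL; rewrite !aE.
  have : (d.+1 * (2 * n - 1) < 2 * N)%N.
    by rewrite /N mulnCA ltn_pmul2l//; lia.
  move: N0; clearbody N; move: (a p) (a q) (d.+1 * _)%N => x y M; nia.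
rewrite aE; have [ai|ai|->] := ltrgtP (a i) 0; last by rewrite mul0r.
  have : \sum_(i < d.+1) a i < 0.
    rewrite (bigD1 i)//= ltr_wnDr// sumr_le0// => j _.
    by have := a1 j i; lia.
  by rewrite asum.
have : 0 < \sum_(i < d.+1) a i.
  rewrite (bigD1 i)//= ltr_wpDr// sumr_ge0// => j _.
  by have := a1 i j; lia.
by rewrite asum.
Qed.

(** The discrete counterpart of [mean_triangle_TC]: only the characters that are
    trivial on all nodes survive. *)
Lemma cubature_TC k : Lambda (2 * n - 1) k ->
  cubature n (TC k) = [forall i, tnth k i == 0]%:R :> R[i].
Proof.
move=> kL; have [kH _ _] := kL.
rewrite cubature_cell; last by move=> h j; exact: TC_node_residues.
have v0 := volume_neq0; have f0 := fact_neq0.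
under eq_bigr => y _ do rewrite TC_node//.
rewrite -mulr_sumr exchange_big /=.
rewrite (eq_bigr (fun=> volume * [forall i, tnth k i == 0]%:R)); last first.
  move=> s _; under eq_bigr => y _ do rewrite chi_permv.
  rewrite sum_chi_cell//; last exact: latticeH_permv.
  rewrite -Lambda_dvd_eq0//; congr (_ * (nat_of_bool _)%:R).
  apply/forallP/forallP => kN i; last by rewrite tnth_mktuple.
  by have := kN (s i); rewrite tnth_mktuple permK.
rewrite sumr_const card_Sn -[X in _ * (_ * X)]mulr_natl.
by rewrite [X in _ * X]mulrA mulVf// mul1r mulrA mulVf ?mul1r.
Qed.

Lemma cubature_sum (L : seq (d.+1.-tuple int)) (c : d.+1.-tuple int -> R[i])
    (F : d.+1.-tuple int -> d.+1.-tuple R -> R[i]) :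
  cubature n (fun t => \sum_(k <- L) c k * F k t) =
  \sum_(k <- L) c k * cubature n (F k).
Proof.
have [L' [_ _ sumE]] := Lambda_enum d n; rewrite /cubature sumE.
under eq_bigr do rewrite mulr_sumr.
rewrite exchange_big /= mulr_sumr; apply: eq_bigr => k _.
rewrite sumE [RHS]mulrCA; congr (_ * _); rewrite mulr_sumr.
by apply: eq_bigr => j _; rewrite mulrCA.
Qed.

Lemma node_triangleH j : Lambda n j -> @triangleH R d (node R n j).
Proof.
move=> jL; have [[j0 _] _ _] := jL.
have NR : (0 : R) < N%:R by rewrite ltr0n.
split.
  rewrite /hyperplane /=; under eq_bigr do rewrite tnth_mktuple.
  by rewrite -mulr_suml -rmorph_sum /= j0 mul0r.
move=> p q pq; rewrite !tnth_mktuple -/N -mulrBl -intrB.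
have := Lambda_le jL (ltnW pq); have := Lambda_width p q jL => h1 h2.
rewrite divr_ge0 ?ler0z ?subr_ge0 ?ler0n//= ler_pdivrMr// mul1r.
by rewrite -[N%:R]/(N%:Z%:~R) ler_int lerBlDl.
Qed.

Lemma mean_triangle_sum (L : seq (d.+1.-tuple int)) (c : d.+1.-tuple int -> R[i]) :
  mean_triangle (fun t : d.+1.-tuple R => \sum_(k <- L) c k * TC k t) =
  \sum_(k <- L) c k * mean_triangle (TC k).
Proof.
have mD := @measurable_triangleH R d.
have Dfin : (@surface R d (@triangleH R d) < +oo)%E.
  by rewrite [ltLHS]surface_triangleH ltry.
rewrite mean_triangleE cintegral_sum//; last first.
  by move=> k; apply: cbounded_measM; [exact: cbounded_meas_cst|exact: cbounded_meas_TC].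
rewrite mulr_sumr; apply: eq_bigr => k _.
rewrite mean_triangleE cintegralZ//; last exact: cbounded_meas_TC.
by rewrite mulrCA.
Qed.

Lemma TCspan_cubature (f : d.+1.-tuple R -> R[i]) :
  TCspan (2 * n - 1) f -> mean_triangle f = cubature n f.
Proof.
move=> [c fE]; have [L [_ LP sumE]] := Lambda_enum d (2 * n - 1).
transitivity (mean_triangle (fun t : d.+1.-tuple R => \sum_(k <- L) c k * TC k t)).
  rewrite !mean_triangleE; congr (_ * _); apply: eq_cintegral => t tD.
  by rewrite fE// sumE.
rewrite (@eq_cubature _ (fun t => \sum_(k <- L) c k * TC k t)); last first.
  by move=> j jL; rewrite fE ?sumE//; exact: node_triangleH.
rewrite mean_triangle_sum cubature_sum; apply: eq_big_seq => k /LP kL.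
by rewrite cubature_TC// mean_triangle_TC//; case: kL.
Qed.

Lemma chi_mul_conj k j h :
  chi R n k h * (chi R n j h)^*%C =
  chi R n [tuple tnth k i - tnth j i | i < d.+1] h.
Proof.
rewrite /chi conjc_expi -expiD; congr expi; rewrite -mulrN -mulrDr; congr (_ * _).
rewrite -mulNr -mulrDl -intrN -intrD; congr (_%:~R / _).
rewrite /dot -sumrB; apply: eq_bigr => i _.
by rewrite tnth_mktuple mulrBl.
Qed.

Lemma latticeHB k j : latticeH k -> latticeH j ->
  latticeH [tuple tnth k i - tnth j i | i < d.+1].
Proof.
move=> [k0 km] [j0 jm]; split.
  by under eq_bigr do rewrite tnth_mktuple; rewrite sumrB k0 j0 subrr.
move=> p q; rewrite !tnth_mktuple; apply/eqP; rewrite eqz_mod_dvd.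
have -> : tnth k p - tnth j p - (tnth k q - tnth j q) =
  (tnth k p - tnth k q) - (tnth j p - tnth j q) by ring.
by apply: rpredB; rewrite -eqz_mod_dvd; apply/eqP; [exact: km|exact: jm].
Qed.

(** After expanding both cosines, the pair of permutations [(s, r)] contributes
    if and only if the residues of [k] rearranged by [s] equal those of [j]
    rearranged by [r].  For [k <> j] this never happens, as [Lambda n] is a
    fundamental domain; for [k = j] every [r] leaves a coset of the stabilizer
    for [s], whose size is [(d+1)! / lambda k]. *)
Lemma ip_discrete_TC k j : Lambda n k -> Lambda n j ->
  ip_discrete n (@TC d R k) (@TC d R j) = (k == j)%:R / (lambda R n k)%:C%C.
Proof.
move=> kL jL; have [kH _ _] := kL; have [jH _ _] := jL.
have v0 := volume_neq0; have f0 := fact_neq0.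
rewrite /ip_discrete cubature_cell; last first.
  move=> h h' hH h'H hh'.
  by rewrite (TC_node_residues R n0 kH hH h'H hh') (TC_node_residues R n0 jH hH h'H hh').
pose x := residues N k; pose z := residues N j.
have E (s r : 'S_d.+1) : \sum_(y : cell)
    chi R n k (permv s (cell_point y)) * (chi R n j (permv r (cell_point y)))^*%C =
    volume * (permv (s^-1)%g x == permv (r^-1)%g z)%:R.
  under eq_bigr => y _ do rewrite !chi_permv chi_mul_conj.
  rewrite sum_chi_cell//; last by apply: latticeHB; exact: latticeH_permv.
  congr (_ * (nat_of_bool _)%:R); rewrite -!residues_permv.
  apply/forallP/eqP => [xz|xz i].
    apply: eq_from_tnth => i; rewrite !tnth_residues; apply/eqP.
    by rewrite eqz_mod_dvd; have := xz i; rewrite tnth_mktuple.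
  rewrite tnth_mktuple -eqz_mod_dvd.
  by have := congr1 (fun t => tnth t i) xz; rewrite !tnth_residues => ->.
have S : \sum_(y : cell) TC k (node R n (cell_point y)) *
      (TC j (node R n (cell_point y)))^*%C =
    volume * ((d.+1`!%:R)^-1 * ((d.+1`!%:R)^-1 *
      \sum_(s : 'S_d.+1) \sum_(r : 'S_d.+1) (permv s x == permv r z)%:R)).
  pose g (y : cell) s r := chi R n k (permv s (cell_point y)) *
    (chi R n j (permv r (cell_point y)))^*%C.
  transitivity ((d.+1`!%:R)^-1 * ((d.+1`!%:R)^-1 *
      \sum_(s : 'S_d.+1) \sum_(r : 'S_d.+1) \sum_(y : cell) g y s r)).
    rewrite [in RHS](eq_bigr _ (fun s _ => exchange_big _ _ _ _ _ _)) /=.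
    rewrite [in RHS]exchange_big !mulr_sumr; apply: eq_bigr => y _ /=.
    rewrite !TC_node// rmorphM fmorphV rmorph_nat mulrACA -mulrA; congr (_ * (_ * _)).
    rewrite big_distrl /=; apply: eq_bigr => s _.
    by rewrite rmorph_sum mulr_sumr.
  rewrite [RHS]mulrCA; congr (_ * _); rewrite [RHS]mulrCA; congr (_ * _).
  rewrite [in RHS](reindex_inj (@invg_inj 'S_d.+1)) mulr_sumr.
  apply: eq_bigr => s _; rewrite [in RHS](reindex_inj (@invg_inj 'S_d.+1)) mulr_sumr.
  by apply: eq_bigr => r _; exact: E.
rewrite S mulKf//; have [kj|kj] := eqVneq k j; last first.
  rewrite mul0r big1 ?mulr0// => s _; rewrite big1// => r _.
  case: eqP => // sr; case/eqP: kj; apply: (Lambda_residues_inj n0 kL jL).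
  rewrite -(permPl (perm_permv x s)) sr; exact: perm_permv.
rewrite mul1r lambda_permutations// rmorph_nat /z -kj -/x.
rewrite exchange_big (eq_bigr (fun=> (#|[pred s : 'S_d.+1 | permv s x == x]|)%:R)); last first.
  move=> r _; rewrite -(card_permv_eq x r) -sum1_card natr_sum [RHS]big_mkcond /=.
  by apply: eq_bigr => s _; rewrite unfold_in /=; case: eqP.
rewrite sumr_const card_Sn -[X in _ * (_ * X)]mulr_natl mulKf//.
have st := card_stabilizer x; have p0 : ((size (permutations x))%:R : R[i]) != 0.
  rewrite pnatr_eq0; apply: contraTneq (fact_gt0 d.+1) => p0.
  by rewrite -st p0 muln0.
by rewrite -st natrM mulrC invfM mulrA mulfV ?mul1r// pnatr_eq0;
  apply: contraTneq (fact_gt0 d.+1) => s0; rewrite -st s0 mul0n.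
Qed.

End Cubature.

Theorem theorem4p4 (R : realType) (d n : nat) (hd : (1 <= d)%N) (hn : (1 <= n)%N) :
  [/\ (forall f g : d.+1.-tuple R -> R[i],
         TCspan (2 * n - 1) (fun t => f t * (g t)^*%C) ->
         ip_triangle f g = ip_discrete n f g),
      (forall f : d.+1.-tuple R -> R[i],
         TCspan (2 * n - 1) f ->
         mean_triangle f = cubature n f)
    & (forall k j : d.+1.-tuple int, Lambda n k -> Lambda n j ->
         ip_discrete n (@TC d R k) (@TC d R j)
         = (k == j)%:R / (lambda R n k)%:C%C)].
Proof.
have int f := @TCspan_cubature R d n hd hn f.
split=> [f g fg|f fS|k j kL jL]; [exact: int|exact: int|].
exact: ip_discrete_TC.
Qed.
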